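(* Let $\mathcal{C}=\langle E,c,\{\mathcal{R}_i\}_{i=1}^n\rangle$ be a covering problem. Suppose there is a polynomial-time $\alpha_{off}$-approximation algorithm for the augmentation problem of $\mathcal{C}$, and a polynomial-time deterministic $\alpha_{on}$-competitive online algorithm for $\mathcal{C}$. Then there is a universal constant $K$ and a polynomial-time algorithm which, given $\Omega=\mathcal{M}\cap\mathcal{K}$ where $\mathcal{M}\subseteq 2^{[n]}$ is a $p$-system (accessed by a membership oracle) and $\mathcal{K}$ is a $q$-knapsack family, outputs $\omega\in\Omega$ with $$\max_{B\in\Omega}\mathrm{Opt}(B)\le K\,(p+1)(q+1)\,\alpha_{off}\,\alpha_{on}\cdot\mathrm{Opt}(\omega).$$ That is, there is an $O((p+1)(q+1)\alpha_{off}\alpha_{on})$-approximation algorithm for the max-min problem $\max_{\omega\in\Omega}\mathrm{Opt}(\omega)$.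
   Context: A covering problem $\mathcal{C}=\langle E,c,\{\mathcal{R}_i\}_{i=1}^n\rangle$ consists of a finite ground set $E$ with costs $c:E\to\mathbb{R}_{\ge0}$ ($c(F)=\sum_{e\in F}c_e$) and $n$ requirements, requirement $i$ given by an upward-closed family $\mathcal{R}_i\subseteq 2^E$; $F\subseteq E$ satisfies requirement $i$ iff $F\in\mathcal{R}_i$. For $S\subseteq E$, $X\subseteq[n]$: $\mathrm{Opt}_{aug}(X\mid S)=\min\{c(A):A\subseteq E,\ S\cup A\in\mathcal{R}_i\ \forall i\in X\}$ and $\mathrm{Opt}(X)=\mathrm{Opt}_{aug}(X\mid\emptyset)$. An $\alpha_{off}$-approximation algorithm for the augmentation problem takes any $S\subseteq E$, $X\subseteq[n]$ and outputs $A\subseteq E$ such that $S\cup A\in\mathcal{R}_i$ for all $i\in X$ and $c(A)\le\alpha_{off}\,\mathrm{Opt}_{aug}(X\mid S)$. In the online version of $\mathcal{C}$, requirements arrive one at a time in a sequence $\sigma$; a deterministic online algorithm $\mathcal{A}_{on}$ maintains $\mathcal{A}_{on}(\sigma)\subseteq E$ satisfying all arrived requirements, only adding elements ($\mathcal{A}_{on}(\sigma)\subseteq\mathcal{A}_{on}(\sigma\circ e)$); it is $\alpha_{on}$-competitive if $c(\mathcal{A}_{on}(\sigma))\le\alpha_{on}\mathrm{Opt}(\text{requirements in }\sigma)$ for all $\sigma$. A $p$-system is a downward-closed family $\mathcal{M}\subseteq 2^{[n]}$ such that for every $A\subseteq[n]$, any two inclusion-maximal members of $\mathcal{M}$ contained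 in $A$ have sizes within a factor $p$. A $q$-knapsack family is $\mathcal{K}=\{A\subseteq[n]:\sum_{e\in A}w^j(e)\le b_j\ \forall j\in[q]\}$ for given nonnegative weight vectors $w^1,\dots,w^q:[n]\to\mathbb{R}_{\ge0}$ and capacities $b_1,\dots,b_q\ge 0$. *)

(* Defs.v *)
From mathcomp Require Import all_boot all_order all_algebra.

Set Implicit Arguments.
Unset Strict Implicit.
Unset Printing Implicit Defensive.

Import Order.TTheory GRing.Theory Num.Theory.

Local Open Scope ring_scope.

(* The ground set is {0, .., nelt - 1}, the requirements are
   {0, .., nreq - 1}. *)
Record covering (R : realFieldType) := Covering {
  nelt : nat;
  nreq : nat;
  cost : 'I_nelt -> R;
  cost_ge0 : forall e, 0 <= cost e;
  req : 'I_nreq -> {set {set 'I_nelt}};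
  req_up : forall i (A B : {set 'I_nelt}),
    A \subset B -> A \in req i -> B \in req i
}.

Section Covering.
Variables (R : realFieldType) (C : covering R).
Implicit Types (S A : {set 'I_(nelt C)}) (X : {set 'I_(nreq C)}).

Definition costs A : R := \sum_(e in A) cost e.

Definition satisfies A X : bool := [forall i in X, A \in req i].

(* Every cost is at most the cost of the whole ground set, so the initial
   value of the iterated minimum matters only if no augmentation is feasible,
   in which case there is no augmentation algorithm either. *)
Definition opt_aug X S : R :=
  \big[Num.min/costs setT]_(A : {set 'I_(nelt C)} | satisfies (S :|: A) X)
    costs A.

Definition opt X : R := opt_aug X set0.

Definition augmentation (alpha : R) X S A : Prop :=
  satisfies (S :|: A) X /\ costs A <= alpha * opt_aug X S.

Definition online_algorithm (Aon : seq 'I_(nreq C) -> {set 'I_(nelt C)}) :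
    Prop :=
  (forall s, satisfies (Aon s) [set i in s]) /\
  (forall s i, Aon s \subset Aon (rcons s i)).

Definition competitive (alpha : R)
    (Aon : seq 'I_(nreq C) -> {set 'I_(nelt C)}) : Prop :=
  forall s, costs (Aon s) <= alpha * opt [set i in s].

Definition max_opt (Omega : {set {set 'I_(nreq C)}}) : R :=
  \big[Num.max/0]_(B in Omega) opt B.

End Covering.

Definition p_system (R : realFieldType) (n : nat) (p : R)
    (M : {set {set 'I_n}}) : Prop :=
  [/\ set0 \in M,
      forall A B : {set 'I_n}, A \subset B -> B \in M -> A \in M
    & forall A B1 B2 : {set 'I_n},
        maxset (fun B => (B \in M) && (B \subset A)) B1 ->
        maxset (fun B => (B \in M) && (B \subset A)) B2 ->
        #|B1|%:R <= p * #|B2|%:R].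

Definition knapsack (R : realFieldType) (n q : nat)
    (w : 'I_q -> 'I_n -> R) (b : 'I_q -> R) : {set {set 'I_n}} :=
  [set A : {set 'I_n} | [forall j, \sum_(e in A) w j e <= b j]].

(* The machine model.  Data are binary trees with numbers at the leaves.
   Programs are written in a first-order language with loops; every evaluation
   step, in particular every field operation, comparison of numbers and oracle
   call, has unit cost.  There is no rounding and the only constants are natural
   numbers.  So this is essentially the WHILE language of Jones (which has the
   same polynomial-time problems as Turing machines) on pure trees, and the
   real RAM or Blum-Shub-Smale machine on numbers. *)

Inductive data (R : Type) :=
| Nil
| Num of R
| Cons of data R & data R.
Arguments Nil {R}.

Fixpoint dsize (R : Type) (x : data R) : nat :=
  if x is Cons y z then (dsize y + dsize z).+1 else 1%N.

Inductive arith := Add | Sub | Mul | Div.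

(* Division by zero returns zero. *)
Definition arith_fun (R : realFieldType) (o : arith) (x y : R) : R :=
  match o with
  | Add => x + y
  | Sub => x - y
  | Mul => x * y
  | Div => x / y
  end.

(* Variables are de Bruijn indices into the environment. *)
Inductive prog :=
| Var of nat
| Let of prog & prog                 (* binds 1 variable in the second *)
| PNil
| PCons of prog & prog
| Case of prog & prog & prog & prog  (* Nil, Num, Cons; the last binds 2 *)
| Const of nat
| Arith of arith & prog & prog
| IfLe of prog & prog & prog & prog
| Ask of prog
| Loop of prog.

(* [eval O env P y t]: with oracle [O], program [P] returns [y] in [t] steps.
   [Loop P] iterates [P] on the first variable of the environment: [P] returns
   a pair whose first component tells whether to stop ([Nil]) or to continue,
   and whose second component is the final, resp. the next, value. *)
Inductive eval (R : realFieldType) (O : data R -> data R -> Prop) :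
  seq (data R) -> prog -> data R -> nat -> Prop :=
| EVar env i x :
    onth env i = Some x -> eval O env (Var i) x 1
| ELet env P Q x y s t :
    eval O env P x s -> eval O (x :: env) Q y t ->
    eval O env (Let P Q) y (s + t).+1
| ENil env :
    eval O env PNil Nil 1
| ECons env P Q x y s t :
    eval O env P x s -> eval O env Q y t ->
    eval O env (PCons P Q) (Cons x y) (s + t).+1
| ECaseNil env P Q0 Q1 Q2 y s t :
    eval O env P Nil s -> eval O env Q0 y t ->
    eval O env (Case P Q0 Q1 Q2) y (s + t).+1
| ECaseNum env P Q0 Q1 Q2 a y s t :
    eval O env P (Num a) s -> eval O env Q1 y t ->
    eval O env (Case P Q0 Q1 Q2) y (s + t).+1
| ECaseCons env P Q0 Q1 Q2 x1 x2 y s t :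
    eval O env P (Cons x1 x2) s -> eval O (x1 :: x2 :: env) Q2 y t ->
    eval O env (Case P Q0 Q1 Q2) y (s + t).+1
| EConst env n :
    eval O env (Const n) (Num n%:R) 1
| EArith env o P Q a b s t :
    eval O env P (Num a) s -> eval O env Q (Num b) t ->
    eval O env (Arith o P Q) (Num (arith_fun o a b)) (s + t).+1
| EIfLe env P1 P2 Q1 Q2 a b y s1 s2 t :
    eval O env P1 (Num a) s1 -> eval O env P2 (Num b) s2 ->
    eval O env (if a <= b then Q1 else Q2) y t ->
    eval O env (IfLe P1 P2 Q1 Q2) y (s1 + s2 + t).+1
| EAsk env P x y s :
    eval O env P x s -> O x y ->
    eval O env (Ask P) y s.+1
| ELoopStop env P x y s :
    eval O (x :: env) P (Cons Nil y) s ->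
    eval O (x :: env) (Loop P) y s.+1
| ELoopNext env P x f1 f2 x' y s t :
    eval O (x :: env) P (Cons (Cons f1 f2) x') s ->
    eval O (x' :: env) (Loop P) y t ->
    eval O (x :: env) (Loop P) y (s + t).+1.

Definition outputs_within (R : realFieldType) (O : data R -> data R -> Prop)
    (P : prog) (x y : data R) (T : nat) : Prop :=
  exists2 t, (t <= T)%N & eval O [:: x] P y t.

Definition no_oracle (R : Type) (x y : data R) : Prop := False.

Section Encodings.
Variable R : realFieldType.

Definition enc_list (s : seq (data R)) : data R := foldr (@Cons R) Nil s.

Definition enc_bool (b : bool) : data R := if b then Cons Nil Nil else Nil.

(* Unary, so that the size of a covering problem bounds its number of
   requirements. *)
Definition enc_nat (n : nat) : data R := enc_list (nseq n Nil).

Definition enc_vec (n : nat) (f : 'I_n -> R) : data R :=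
  enc_list [seq Num (f i) | i <- enum 'I_n].

Definition enc_set (n : nat) (A : {set 'I_n}) : data R :=
  enc_list [seq enc_bool (i \in A) | i <- enum 'I_n].

Definition enc_seq (n : nat) (s : seq 'I_n) : data R :=
  enc_list [seq enc_nat (nat_of_ord i) | i <- s].

Definition enc_knapsack (n q : nat) (w : 'I_q -> 'I_n -> R) (b : 'I_q -> R) :
    data R :=
  enc_list [seq Cons (Num (b j)) (enc_vec (w j)) | j <- enum 'I_q].

(* The requirement families may be given implicitly, e.g. by a graph: [d] is
   an arbitrary description of them. *)
Definition enc_covering (C : covering R) (d : data R) : data R :=
  Cons (enc_vec (@cost R C)) (Cons (enc_nat (nreq C)) d).

Definition membership_oracle (n : nat) (M : {set {set 'I_n}})
    (x y : data R) : Prop :=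
  exists2 A : {set 'I_n}, x = enc_set A & y = enc_bool (A \in M).

End Encodings.

(* "Polynomial time" only makes sense for a class of covering problems: below
   [C i] is the instance with index [i] and [desc i] its description.  One
   program must handle all instances. *)

Section Algorithms.
Variables (R : realFieldType) (I : Type).
Variables (C : I -> covering R) (desc : I -> data R).

Let inst (i : I) : data R := enc_covering (C i) (desc i).

Definition poly_time_augmentation (alpha : I -> R) : Prop :=
  exists (P : prog) (k d : nat),
  forall (i : I) (S : {set 'I_(nelt (C i))}) (X : {set 'I_(nreq (C i))}),
    let x := Cons (inst i) (Cons (enc_set R S) (enc_set R X)) in
    exists2 A : {set 'I_(nelt (C i))},
      outputs_within (@no_oracle R) P x (enc_set R A) (k * dsize x ^ d)%N
      & augmentation (alpha i) X S A.

Definition poly_time_online (alpha : I -> R) : Prop :=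
  exists Aon : forall i, seq 'I_(nreq (C i)) -> {set 'I_(nelt (C i))},
  [/\ forall i, online_algorithm (Aon i),
      forall i, competitive (alpha i) (Aon i)
    & exists (P : prog) (k d : nat),
      forall (i : I) (s : seq 'I_(nreq (C i))),
        let x := Cons (inst i) (enc_seq R s) in
        outputs_within (@no_oracle R) P x (enc_set R (Aon i s))
          (k * dsize x ^ d)%N].

Definition poly_time_max_min (factor : I -> R -> nat -> R) : Prop :=
  exists (P : prog) (k d : nat),
  forall (i : I) (p : R) (M : {set {set 'I_(nreq (C i))}})
         (q : nat) (w : 'I_q -> 'I_(nreq (C i)) -> R) (b : 'I_q -> R),
    p_system p M -> (forall j e, 0 <= w j e) -> (forall j, 0 <= b j) ->
    let Omega := M :&: knapsack w b in
    let x := Cons (inst i) (enc_knapsack w b) in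
    exists omega : {set 'I_(nreq (C i))},
    [/\ outputs_within (membership_oracle M) P x (enc_set R omega)
          (k * dsize x ^ d)%N,
        omega \in Omega
      & max_opt Omega <= factor i p q * opt omega].

End Algorithms.

(* Main.v *)
Require Import Defs.
From mathcomp Require Import all_boot all_order all_algebra.
From mathcomp Require Import zify lra.
(* The notation [Num] of ssrnat hides the constructor of [data]. *)
Import Defs.

(** The algorithm is greedy.  Let [gain S e] be the cost of the offline
augmentation of [S] for the single requirement [e], and let
[weight e = \sum_j w j e / b j].  A greedy run with density threshold [rho]
feeds to the online algorithm, whose current solution is [S], the element of
largest gain among those that keep [A] in [M] and have
[rho * weight e <= gain S e].  It stops when the total weight would exceed 1.

The sum [L] of the gains is at most [alpha_off] times the online cost, so
[L + costs S] is at most [2 * alpha_off * alpha_on * opt A], and a single gain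
is at most [alpha_off * opt [set e]].  This certifies the value of the sets
[A] and [[set e]] met during a run.  If the run stops because [e] does not fit,
then [rho < L + gain S e], so one certified value exceeds [rho / 2].  If no
candidates are left, then for [B] in [Omega] the elements of low density cost at
most [rho * q] more than [S], because [B] weighs at most [q], and the others
are blocked by [M] and are charged to the greedy choices, at most [p * L] in
all; so [opt B <= rho * q + costs S + p * L].

The next run takes for [rho] four times the best certified value.  Either
this value doubles, or it is good enough.  After the first run it is within a
factor [4 * q + 1] of each [opt [set e]], so [nreq C] runs are enough. *)

Set Implicit Arguments.
Unset Strict Implicit.
Unset Printing Implicit Defensive.

Import Order.TTheory GRing.Theory Num.Theory.

Local Open Scope ring_scope.

(** * Program evaluation *)

Section Evaluation.
Variables (R : realFieldType).
Implicit Types (O : data R -> data R -> Prop) (env : seq (data R)).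
Implicit Types (x y z : data R) (P Q F : prog).

(** The new variables go behind the old ones, where no index used in the evaluation points. This
    serves both to call a program inside a larger one and to run an oracle-free program under an
    oracle. *)
Lemma eval_weaken O O' env env' P y t :
  (forall x z, O x z -> O' x z) -> eval O env P y t ->
  eval O' (env ++ env') P y t.
Proof.
move=> sub; elim=> /= {env P y t}; try by move=> *; econstructor; eauto.
move=> env i x h; apply: EVar; rewrite onth_cat.
by case: ltnP => // le_i; rewrite onth_default in h.
Qed.

(** Only an upper bound on the steps is kept, so that branches of different length can share one
    bound. *)
Definition ev O env P y T := exists2 t, (t <= T)%N & eval O env P y t.

Lemma ev_le O env P y T T' : ev O env P y T -> (T <= T')%N -> ev O env P y T'.
Proof. by case=> t le_t e le_T; exists t => //; apply: leq_trans le_T. Qed.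

Lemma ev_var O env i x : onth env i = Some x -> ev O env (Var i) x 1.
Proof. by exists 1%N => //; constructor. Qed.

Lemma ev_let O env P Q x y s t :
  ev O env P x s -> ev O (x :: env) Q y t -> ev O env (Let P Q) y (s + t).+1.
Proof.
move=> [s' ? e] [t' ? e']; exists (s' + t').+1; first lia.
by apply: ELet e e'.
Qed.

(** Subroutine call: [Q] is specified on an environment with its argument alone, and finds this
    argument on top of [env]. *)
Lemma ev_call O env P Q x y s t :
  ev O env P x s -> outputs_within O Q x y t ->
  ev O env (Let P Q) y (s + t).+1.
Proof.
move=> e [t' ? e']; apply: ev_let e _; exists t' => //.
by apply: (@eval_weaken O O [:: x]).
Qed.

Lemma ev_nil O env : ev O env PNil Nil 1.
Proof. by exists 1%N => //; constructor. Qed.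

Lemma ev_const O env n : ev O env (Const n) (Num n%:R) 1.
Proof. by exists 1%N => //; constructor. Qed.

Lemma ev_cons O env P Q x y s t :
  ev O env P x s -> ev O env Q y t ->
  ev O env (PCons P Q) (Cons x y) (s + t).+1.
Proof.
move=> [s' ? e] [t' ? e']; exists (s' + t').+1; first lia.
by apply: ECons e e'.
Qed.

Lemma ev_case_nil O env P Q0 Q1 Q2 y s t :
  ev O env P Nil s -> ev O env Q0 y t ->
  ev O env (Case P Q0 Q1 Q2) y (s + t).+1.
Proof.
move=> [s' ? e] [t' ? e']; exists (s' + t').+1; first lia.
by apply: ECaseNil e e'.
Qed.

Lemma ev_case_num O env P Q0 Q1 Q2 a y s t :
  ev O env P (Num a) s -> ev O env Q1 y t ->
  ev O env (Case P Q0 Q1 Q2) y (s + t).+1.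
Proof.
move=> [s' ? e] [t' ? e']; exists (s' + t').+1; first lia.
by apply: ECaseNum e e'.
Qed.

Lemma ev_case_cons O env P Q0 Q1 Q2 x1 x2 y s t :
  ev O env P (Cons x1 x2) s -> ev O (x1 :: x2 :: env) Q2 y t ->
  ev O env (Case P Q0 Q1 Q2) y (s + t).+1.
Proof.
move=> [s' ? e] [t' ? e']; exists (s' + t').+1; first lia.
by apply: ECaseCons e e'.
Qed.

Lemma ev_arith O env o P Q a b c s t :
  ev O env P (Num a) s -> ev O env Q (Num b) t -> arith_fun o a b = c ->
  ev O env (Arith o P Q) (Num c) (s + t).+1.
Proof.
move=> [s' ? e] [t' ? e'] <-; exists (s' + t').+1; first lia.
by apply: EArith e e'.
Qed.

Lemma ev_ifle O env P1 P2 Q1 Q2 (a b : R) y s1 s2 t :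
  ev O env P1 (Num a) s1 -> ev O env P2 (Num b) s2 ->
  ev O env (if a <= b then Q1 else Q2) y t ->
  ev O env (IfLe P1 P2 Q1 Q2) y (s1 + s2 + t).+1.
Proof.
move=> [s' ? e] [t' ? e'] [u' ? e'']; exists (s' + t' + u').+1; first lia.
by apply: EIfLe e e' e''.
Qed.

Lemma ev_ask O env P x y s :
  ev O env P x s -> O x y -> ev O env (Ask P) y s.+1.
Proof. by move=> [s' ? e] o; exists s'.+1 => //; apply: EAsk e o. Qed.

Lemma outputs_no_oracle O P x y T :
  outputs_within (@no_oracle R) P x y T -> outputs_within O P x y T.
Proof.
by move=> [t ? e]; exists t => //; rewrite -[[:: x]]cats0; apply: eval_weaken e.
Qed.

(* On a pair of a list and an initial value, a left fold of the list; the body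
   sees the current item as [Var 0], the accumulator as [Var 3] and the
   enclosing environment from [Var 5] on. *)
Definition Fold F :=
  Loop (Case (Var 0) PNil PNil
    (Case (Var 0) (PCons PNil (Var 1)) PNil
      (PCons (PCons PNil PNil) (PCons (Var 1) F)))).

(** The invariant is indexed by the number of consumed items. It is a predicate because the states
    of the greedy loops are known only through a specification. *)
Lemma ev_fold (Inv : nat -> data R -> Prop) O env F s x0 n T :
  (size s <= n)%N -> Inv 0%N x0 ->
  (forall i x, (i < size s)%N -> Inv i x ->
     forall tl l st, exists2 x',
       ev O [:: nth Nil s i, tl, l, x, st & env] F x' T & Inv i.+1 x') ->
  exists2 x, ev O (Cons (enc_list s) x0 :: env) (Fold F) x (n * (T + 12) + 10)%N
           & Inv (size s) x.
Proof.
move=> le_n I0 step.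
(* Induction on the number [m] of remaining items, with the loop started on a suffix of [s]. *)
suff: forall m i x, (i + m = size s)%N -> Inv i x ->
    exists2 x', ev O (Cons (enc_list (drop i s)) x :: env) (Fold F) x'
      (m * (T + 12) + 10)%N & Inv (size s) x'.
  move=> /(_ (size s) 0%N x0 erefl I0); rewrite drop0 => -[x e Ix].
  exists x => //; apply: ev_le e _; rewrite leq_add2r leq_mul2r le_n.
  by rewrite orbT.
elim=> [|m IH] i x eq_i Ix.
  exists x; last by rewrite -eq_i addn0.
  rewrite drop_oversize; last by lia.
  exists 8%N => //; apply: ELoopStop.
  apply: (ECaseCons _ _ (EVar _ _)) => //.
  apply: (ECaseNil _ _ (EVar _ _)) => //.
  by apply: (ECons (ENil _ _) (EVar _ _)).
have lt_i : (i < size s)%N by lia.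
rewrite (drop_nth Nil lt_i) /=.
have [x' [t le_t e] Ix'] := step i x lt_i Ix (enc_list (drop i.+1 s))
   (Cons (nth Nil s i) (enc_list (drop i.+1 s)))
   (Cons (Cons (nth Nil s i) (enc_list (drop i.+1 s))) x).
have [|x'' [t' le_t' e'] Ix''] := IH i.+1 x' _ Ix'; first lia.
exists x'' => //; eexists; last first.
  apply: ELoopNext; last exact: e'.
  apply: (ECaseCons _ _ (EVar _ _)) => //.
  apply: (ECaseCons _ _ (EVar _ _)) => //.
  apply: ECons (ECons (ENil _ _) (ENil _ _)) _.
  by apply: ECons (EVar _ _) e.
nia.
Qed.

Lemma ev_foldl (g : data R -> data R -> data R) O env F s x0 n T :
  (size s <= n)%N ->
  (forall i x, (i < size s)%N -> x = foldl g x0 (take i s) ->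
     forall tl l st,
       ev O [:: nth Nil s i, tl, l, x, st & env] F (g x (nth Nil s i)) T) ->
  ev O (Cons (enc_list s) x0 :: env) (Fold F) (foldl g x0 s)
    (n * (T + 12) + 10)%N.
Proof.
move=> le_n step.
have [|i x lt_i xE tl l st|x] :=
    @ev_fold (fun i x => x = foldl g x0 (take i s)) O env F s x0 n T le_n.
- by rewrite take0.
- exists (g x (nth Nil s i)); first exact: step.
  by rewrite (take_nth Nil lt_i) foldl_rcons -xE.
- by rewrite take_size => + <-.
Qed.

End Evaluation.

Ltac ev_step :=
  lazymatch goal with
  | |- ev _ _ (Var _) _ _ => eapply ev_var; reflexivity
  | |- ev _ _ PNil _ _ => eapply ev_nil
  | |- ev _ _ (PCons _ _) _ _ => eapply ev_cons
  | |- ev _ _ (Const _) _ _ => eapply ev_const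
  | |- ev _ _ (Arith _ _ _) _ _ =>
      eapply ev_arith; [repeat ev_step | repeat ev_step | reflexivity]
  | |- ev _ _ (IfLe _ _ _ _) _ _ => eapply ev_ifle
  | |- ev _ _ (Case (Var ?i) _ _ _) _ _ =>
      first [ eapply ev_case_cons; [eapply ev_var; reflexivity|]
            | eapply ev_case_nil; [eapply ev_var; reflexivity|]
            | eapply ev_case_num; [eapply ev_var; reflexivity|] ]
  end.
Ltac ev_auto := repeat ev_step.
Tactic Notation "ev_run" := eapply ev_le; [ev_auto|].

(** * Programs on lists and bit vectors *)

Section BitPrograms.
Variables (R : realFieldType) (O : data R -> data R -> Prop).
Implicit Types (s : seq (data R)) (x y : data R).

Definition Catrev := Fold (PCons (Var 0) (Var 3)).

Lemma Catrev_ok s1 s2 n : (size s1 <= n)%N ->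
  outputs_within O Catrev (Cons (enc_list s1) (enc_list s2))
    (enc_list (catrev s1 s2)) (n * 15 + 10)%N.
Proof.
move=> le_n.
have -> : enc_list (catrev s1 s2)
        = foldl (fun x y => Cons y x) (enc_list s2) s1.
  by elim: s1 s2 {le_n} => //= x s1 IH s2; rewrite (IH (x :: s2)).
by apply: (@ev_foldl _ _ _ _ _ _ _ _ 3%N) => // i x lt_i xE tl l st; ev_run.
Qed.

(** Items move one by one to the front of the accumulator, so the prefix comes out reversed;
    [Catrev] puts it back in order. *)
Definition SplitAt :=
  Case (Var 0) PNil PNil
    (Let (PCons (Var 0) (PCons PNil (Var 1)))
      (Fold (Case (Var 3) PNil PNil
              (Case (Var 1) PNil PNil
                 (PCons (PCons (Var 0) (Var 2)) (Var 1)))))).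

Lemma SplitAt_ok k s n : (k <= size s)%N -> (k <= n)%N ->
  outputs_within O SplitAt (Cons (enc_nat R k) (enc_list s))
    (Cons (enc_list (rev (take k s))) (enc_list (drop k s))) (n * 21 + 30)%N.
Proof.
move=> le_k le_n; rewrite /SplitAt.
have [||i x lt_i xE tl l st|y ey yE] :=
    @ev_fold _ (fun i y => y = Cons (enc_list (rev (take i s)))
       (enc_list (drop i s))) O
      [:: enc_nat R k; enc_list s; Cons (enc_nat R k) (enc_list s)]
      (Case (Var 3) PNil PNil
              (Case (Var 1) PNil PNil
                 (PCons (PCons (Var 0) (Var 2)) (Var 1))))
      (nseq k Nil) (Cons Nil (enc_list s)) n 9.
- by rewrite size_nseq.
- by rewrite take0 drop0.
- rewrite size_nseq in lt_i; have lt_s := leq_trans lt_i le_k.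
  rewrite {x}xE (drop_nth Nil lt_s) /=.
  eexists; first by ev_run.
  by rewrite (take_nth Nil lt_s) rev_rcons.
rewrite size_nseq in yE; rewrite -yE /=.
eapply ev_le; first by ev_step; eapply ev_let; [ev_auto|exact: ey].
lia.
Qed.

Definition SetBit :=
  Let SplitAt
    (Case (Var 0) PNil PNil
      (Case (Var 1) PNil PNil
        (Let (PCons (Var 2) (PCons (PCons PNil PNil) (Var 1))) Catrev))).

Lemma SetBit_ok n (k : 'I_n) (A : {set 'I_n}) :
  outputs_within O SetBit (Cons (enc_nat R k) (enc_set R A))
    (enc_set R (k |: A)) (n * 40 + 60)%N.
Proof.
have szA : size [seq enc_bool R (i \in A) | i <- enum 'I_n] = n.
  by rewrite size_map -cardE card_ord.
have lt_s : (k < size [seq enc_bool R (i \in A) | i <- enum 'I_n])%N.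
  by rewrite szA.
have -> : enc_set R (k |: A) = enc_list (catrev
   (rev (take k [seq enc_bool R (i \in A) | i <- enum 'I_n]))
   (Cons Nil Nil :: drop k.+1 [seq enc_bool R (i \in A) | i <- enum 'I_n])).
  rewrite catrevE revK; congr enc_list; apply: (@eq_from_nth _ Nil).
    by rewrite size_cat /= size_map -cardE card_ord size_drop size_take szA
               ltn_ord; have := ltn_ord k; lia.
  move=> i; rewrite size_map -cardE card_ord => lt_i.
  rewrite (nth_map k) -?cardE ?card_ord // nth_cat size_take szA ltn_ord.
  rewrite in_setU1 -val_eqE /= nth_enum_ord //; case: ltngtP => [lt_ik|lt_ki|->].
  - by rewrite nth_take // (nth_map k) // -cardE card_ord.
  - have -> : (i - k = (i - k.+1).+1)%N by lia.
    rewrite /= nth_drop subnKC // (nth_map k) // -cardE card_ord //.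
  - by rewrite subnn.
eapply ev_le.
  eapply ev_let.
    by apply: (@SplitAt_ok k _ n); apply: ltnW; rewrite ?szA // ltn_ord.
  rewrite (drop_nth Nil lt_s).
  do 2 ev_step; eapply ev_call.
    rewrite -/(enc_list _); ev_step; ev_auto.
  apply: (@Catrev_ok _ (Cons Nil Nil :: _) n).
  by rewrite size_rev size_take szA ltn_ord ltnW.
lia.
Qed.
End BitPrograms.

(** * Optimal costs and weights *)

Section Opt.
Variables (R : realFieldType) (C : covering R).
Implicit Types (S A : {set 'I_(nelt C)}) (X Y : {set 'I_(nreq C)}).

Lemma costs_ge0 A : 0 <= costs A.
Proof. by apply: sumr_ge0 => e _; apply: cost_ge0. Qed.

Lemma costs0 : costs (set0 : {set 'I_(nelt C)}) = 0.
Proof. by rewrite /costs big_set0. Qed.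

Lemma costs_setD S A : S \subset A -> costs A = costs S + costs (A :\: S).
Proof. by move=> /setIidPr SA; rewrite /costs (big_setID S) /= SA. Qed.

Lemma costsS S A : S \subset A -> costs S <= costs A.
Proof. by move=> /costs_setD ->; rewrite lerDl costs_ge0. Qed.

Lemma costsU S A : costs (S :|: A) <= costs S + costs A.
Proof.
rewrite (costs_setD (subsetUl S A)) lerD2l setDUl setDv set0U.
by rewrite costsS // subsetDl.
Qed.

Lemma satisfies_up S A X : S \subset A -> satisfies S X -> satisfies A X.
Proof.
move=> SA /forallP satS; apply/forallP => i; apply/implyP => iX.
by apply: req_up SA _; apply: (implyP (satS i)).
Qed.

Lemma satisfiesS A X Y : X \subset Y -> satisfies A Y -> satisfies A X.
Proof.
move=> /subsetP XY /forallP satA; apply/forallP => i; apply/implyP => iX.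
by apply: (implyP (satA i)); apply: XY.
Qed.

Lemma satisfies_set1 A X i : satisfies A X -> i \in X -> A \in req i.
Proof. by move=> /forallP/(_ i)/implyP; apply. Qed.

Lemma opt_aug_le X S A : satisfies (S :|: A) X -> opt_aug X S <= costs A.
Proof. by move=> sat; rewrite /opt_aug (bigminD1 A) // ge_min lexx. Qed.

Lemma opt_aug_ge0 X S : 0 <= opt_aug X S.
Proof.
rewrite /opt_aug; elim/big_rec: _ => [|A x _ x_ge0]; first exact: costs_ge0.
by rewrite le_min costs_ge0.
Qed.

Lemma opt_set0 : opt (set0 : {set 'I_(nreq C)}) = 0.
Proof.
apply/eqP; rewrite eq_le opt_aug_ge0 andbT -costs0 opt_aug_le //.
by apply/forallP => i; rewrite inE.
Qed.

Hypothesis feasible : forall X, satisfies (setT : {set 'I_(nelt C)}) X.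

(** The default value [costs setT] of the iterated minimum is itself the cost of a feasible
    augmentation. *)
Lemma opt_aug_attained X S :
  exists2 A, satisfies (S :|: A) X & opt_aug X S = costs A.
Proof.
rewrite /opt_aug; elim/big_rec: _ => [|A x satA [B satB ->]].
  by exists setT; rewrite ?setUT.
by case: (leP (costs A) (costs B)) => _; [exists A | exists B].
Qed.

Lemma opt_aug_anti X S A : S \subset A -> opt_aug X A <= opt_aug X S.
Proof.
move=> SA; have [B satB ->] := opt_aug_attained X S.
by apply: opt_aug_le; apply: satisfies_up satB; apply: setSU.
Qed.

(** The union of [S] with one optimal augmentation per requirement in [X] is feasible for [X]. *)
Lemma opt_le_sum_aug S X :
  opt X <= costs S + \sum_(i in X) opt_aug [set i] S.
Proof.
have /fin_all_exists [f fP] : forall i : 'I_(nreq C), exists A,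
    satisfies (S :|: A) [set i] /\ opt_aug [set i] S = costs A.
  by move=> i; have [A ? ?] := opt_aug_attained [set i] S; exists A.
apply: le_trans (_ : costs (S :|: \bigcup_(i in X) f i) <= _).
  apply: opt_aug_le; rewrite set0U; apply/forallP => i; apply/implyP => iX.
  have [sat_i _] := fP i.
  apply: req_up (satisfies_set1 sat_i (set11 i)).
  by apply: setUS; apply: bigcup_sup.
apply: le_trans (costsU _ _) _; rewrite lerD2l.
elim/big_ind2: _ => [|A x B y leA leB|i _]; first by rewrite costs0.
  by apply: le_trans (costsU _ _) _; apply: lerD.
by have [_ ->] := fP i.
Qed.

End Opt.

Section Weight.
Variables (R : realFieldType) (n q : nat).
Variables (w : 'I_q -> 'I_n -> R) (b : 'I_q -> R).
Hypotheses (w_ge0 : forall j e, 0 <= w j e) (b_ge0 : forall j, 0 <= b j).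
Implicit Types (A : {set 'I_n}) (e : 'I_n).

Definition fits e : bool := [forall j, w j e <= b j].

(* A capacity [0] contributes [0], by the convention on division; then the
   elements that fit have weight [0] too. *)
Definition weight e : R := \sum_j w j e / b j.

Definition weights A : R := \sum_(e in A) weight e.

Lemma weight_ge0 e : 0 <= weight e.
Proof. by apply: sumr_ge0 => j _; rewrite divr_ge0. Qed.

Lemma weights_exchange A : weights A = \sum_j (\sum_(e in A) w j e) / b j.
Proof.
rewrite /weights exchange_big /=; apply: eq_bigr => j _.
by rewrite mulr_suml.
Qed.

Lemma knapsack_weights A : A \in knapsack w b -> weights A <= q%:R.
Proof.
rewrite inE => /forallP inK; rewrite weights_exchange.
apply: le_trans (_ : \sum_(j < q) (1 : R) <= _); last first.
  by rewrite sumr_const card_ord.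
apply: ler_sum => j _; have := b_ge0 j; rewrite le_eqVlt => /orP[/eqP <-|b_gt0].
  by rewrite invr0 mulr0.
by rewrite ler_pdivrMr // mul1r.
Qed.

Lemma knapsack_fits A e : A \in knapsack w b -> e \in A -> fits e.
Proof.
rewrite inE => /forallP inK eA; apply/forallP => j; apply: le_trans (inK j).
by rewrite (big_setD1 e) //= lerDl sumr_ge0.
Qed.

(** Each normalised constraint is a summand of the total weight, so one scalar bound implies all of
    them. Constraints of capacity 0 are invisible in the weight and are covered by [fits]. *)
Lemma weights_le1 A :
  (forall e, e \in A -> fits e) -> weights A <= 1 -> A \in knapsack w b.
Proof.
move=> fitsA; rewrite weights_exchange => le1; rewrite inE; apply/forallP => j.
have := b_ge0 j; rewrite le_eqVlt => /orP[/eqP b0|b_gt0].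
  rewrite -b0; apply: sumr_le0 => e /fitsA /forallP /(_ j).
  by rewrite -b0.
rewrite -[leRHS]mul1r -ler_pdivrMr //; apply: le_trans le1.
rewrite (bigD1 j) //= lerDl sumr_ge0 // => k _.
by rewrite divr_ge0 // sumr_ge0.
Qed.

Lemma fits_knapsack e : fits e -> [set e] \in knapsack w b.
Proof.
by move=> /forallP fits_e; rewrite inE; apply/forallP => j; rewrite big_set1.
Qed.

Lemma weightsU1 A e : e \notin A -> weights (e |: A) = weight e + weights A.
Proof. exact: big_setU1. Qed.

End Weight.

(** Since no element of [T] can be added, [A] is maximal inside [A :|: T]; compare it with a maximal
    member that contains [T]. *)
Lemma p_system_blocked (R : realFieldType) n (p : R) (M : {set {set 'I_n}})
    (A T : {set 'I_n}) :
  p_system p M -> A \in M -> T \in M ->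
  (forall e, e \in T -> e |: A \notin M) -> #|T|%:R <= p * #|A|%:R.
Proof.
move=> [_ downM ratioM] AM TM blocked.
pose Q (B : {set 'I_n}) := (B \in M) && (B \subset A :|: T).
have maxA : maxset Q A.
  apply/maxsetP; split=> [|B /andP[BM BAT] AB]; first by rewrite /Q AM subsetUl.
  apply/eqP; rewrite eqEsubset AB andbT; apply/subsetP => e eB.
  apply: contraT => eA; have /blocked/negP[] : e \in T.
    by have := subsetP BAT e eB; rewrite inE (negPf eA).
  by apply: downM BM; rewrite subUset sub1set eB.
have QT : Q T by rewrite /Q TM subsetUr.
have [B maxB TB] := maxset_exists QT.
apply: le_trans (ratioM (A :|: T) _ _ maxB maxA).
by rewrite ler_nat subset_leq_card.
Qed.

(** * The greedy algorithm *)

Section Greedy.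
Variables (R : realFieldType) (C : covering R).
Notation req := 'I_(nreq C).
Notation elts := {set 'I_(nelt C)}.
Variables (a_off a_on : R) (off : elts -> {set req} -> elts).
Variables (on : seq req -> elts).
Hypothesis offP : forall S X, augmentation a_off X S (off S X).
Hypotheses (onP : online_algorithm on) (on_comp : competitive a_on on).
Hypotheses (a_off_ge1 : 1 <= a_off) (a_on_ge1 : 1 <= a_on).
Variables (q : nat) (w : 'I_q -> req -> R) (b : 'I_q -> R).
Hypotheses (w_ge0 : forall j e, 0 <= w j e) (b_ge0 : forall j, 0 <= b j).
Variables (M : {set {set req}}).
Hypothesis M0 : set0 \in M.
Hypothesis M_down : forall A B : {set req}, A \subset B -> B \in M -> A \in M.

Notation fits := (fits w b).
Notation weight := (weight w b).
Notation weights := (weights w b).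
Notation Omega := (M :&: knapsack w b).

(** Augmenting [setT] adds nothing, yet the offline algorithm succeeds on it. *)
Let feasible X : satisfies (setT : elts) X.
Proof. by have [satX _] := offP setT X; rewrite setTU in satX. Qed.

Definition gain (S : elts) (e : req) : R := costs (off S [set e]).

Lemma gain_ge0 S e : 0 <= gain S e.
Proof. exact: costs_ge0. Qed.

Lemma opt_aug_le_gain S e : opt_aug [set e] S <= gain S e.
Proof. by have [satX _] := offP S [set e]; apply: opt_aug_le. Qed.

Lemma gain_le_opt_aug S e : gain S e <= a_off * opt_aug [set e] S.
Proof. by have [_ ->] := offP S [set e]. Qed.

Definition candidate rho (A : {set req}) S e : bool :=
  [&& fits e, e |: A \in M & rho * weight e <= gain S e].

(** The latest choice is at the head of the list, so [rev r] is the sequence seen by the online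
    algorithm. Demanding a positive gain makes every choice new. *)
Inductive greedy (rho : R) : {set req} -> seq req -> R -> Prop :=
| Greedy0 : greedy rho set0 [::] 0
| GreedyS A r L e :
    greedy rho A r L -> candidate rho A (on (rev r)) e ->
    0 < gain (on (rev r)) e ->
    (forall e', candidate rho A (on (rev r)) e' ->
       gain (on (rev r)) e' <= gain (on (rev r)) e) ->
    weights (e |: A) <= 1 ->
    greedy rho (e |: A) (e :: r) (L + gain (on (rev r)) e).

Lemma on_nil_costs : costs (on [::]) = 0.
Proof.
apply/eqP; rewrite eq_le costs_ge0 andbT; apply: le_trans (on_comp _) _.
by rewrite set_nil opt_set0 mulr0.
Qed.

Section Run.
Variable rho : R.

Lemma greedy_set A r L : greedy rho A r L -> A = [set i in r].
Proof.
elim=> [|{}A {}r {}L e _ -> _ _ _ _]; first by rewrite set_nil.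
by rewrite set_cons.
Qed.

(** The online solution already satisfies [e], so the optimal augmentation is free and an
    approximate one must be free too. *)
Lemma gain_covered A r L e : greedy rho A r L -> e \in A ->
  gain (on (rev r)) e = 0.
Proof.
move=> gA eA; apply/eqP; rewrite eq_le gain_ge0 andbT.
apply: le_trans (gain_le_opt_aug _ _) _.
suff: opt_aug [set e] (on (rev r)) <= 0.
  by move=> le0; rewrite mulr_ge0_le0 // (le_trans _ a_off_ge1).
rewrite -(@costs0 _ C) opt_aug_le // setU0.
apply: satisfiesS (onP.1 (rev r)); rewrite sub1set inE mem_rev.
by rewrite (greedy_set gA) inE in eA.
Qed.

Lemma gain_notin A r L e : greedy rho A r L -> 0 < gain (on (rev r)) e ->
  e \notin A.
Proof. by move=> gA; apply: contraTN => /(gain_covered gA) ->; rewrite ltxx. Qed.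

Lemma greedy_size A r L : greedy rho A r L -> size r = #|A|.
Proof.
elim=> [|{}A {}r {}L e gA IH _ v_gt0 _ _]; first by rewrite cards0.
by rewrite cardsU1 (gain_notin gA v_gt0) /= IH.
Qed.

Lemma greedy_fits A r L e : greedy rho A r L -> e \in A -> fits e.
Proof.
elim=> [|{}A {}r {}L a _ IH /and3P[fits_a _ _] _ _ _]; first by rewrite inE.
by rewrite !inE => /orP[/eqP ->|/IH].
Qed.

Lemma greedy_M A r L : greedy rho A r L -> A \in M.
Proof. by case=> // {}A {}r {}L e _ /and3P[]. Qed.

Lemma greedy_Omega A r L : greedy rho A r L -> A \in Omega.
Proof.
move=> gA; rewrite inE (greedy_M gA) /=; apply: weights_le1 => // [e|].
  exact: greedy_fits gA.
by case: gA => // ; rewrite /weights big_set0.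
Qed.

Lemma greedy_density A r L : greedy rho A r L -> rho * weights A <= L.
Proof.
elim=> [|{}A {}r {}L e gA IH /and3P[_ _ dens] v_gt0 _ _].
  by rewrite /weights big_set0 mulr0.
by rewrite (weightsU1 _ _ (gain_notin gA v_gt0)) mulrDr addrC lerD.
Qed.

Lemma greedy_gain_ge0 A r L : greedy rho A r L -> 0 <= L.
Proof.
by elim=> // {}A {}r {}L e _ IH _ v_gt0 _ _; apply: addr_ge0 => //; apply: ltW.
Qed.

(* After accepting [e] the online algorithm has paid for an augmentation of [S]
   for [e], hence at least [opt_aug [set e] S]. *)
Lemma greedy_gain_le A r L : greedy rho A r L -> L <= a_off * costs (on (rev r)).
Proof.
have a_off_ge0 : 0 <= a_off by apply: le_trans a_off_ge1.
elim=> [|{}A {}r {}L e _ IH _ _ _ _]; first by rewrite mulr_ge0 ?costs_ge0.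
rewrite rev_cons (costs_setD (onP.2 _ e)) mulrDr lerD //.
apply: le_trans (gain_le_opt_aug _ _) _; rewrite ler_wpM2l //.
apply: opt_aug_le; rewrite setDE setUIr setUCr setIT (setUidPr (onP.2 _ _)).
apply: satisfiesS (onP.1 _).
by rewrite sub1set inE mem_rcons inE eqxx.
Qed.

(** Each of the two summands is at most [a_off * a_on * opt A], whence the factor 2. *)
Lemma greedy_value A r L : greedy rho A r L ->
  L + costs (on (rev r)) <= 2 * (a_off * a_on) * opt A.
Proof.
move=> gA; have L_le := greedy_gain_le gA.
have : costs (on (rev r)) <= a_on * opt A.
  rewrite (greedy_set gA); apply: le_trans (on_comp _) _.
  rewrite (_ : [set i in rev r] = [set i in r]) //.
  by apply/setP => i; rewrite !inE mem_rev.
have := costs_ge0 (on (rev r)); have := opt_aug_ge0 A set0; rewrite -/(opt A).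
move: (costs _) (opt A) L_le => u x L_le x_ge0 u_ge0 u_le.
have h1 : a_off * u <= a_off * (a_on * x).
  by rewrite ler_wpM2l // (le_trans _ a_off_ge1).
have h2 : u <= a_off * u by rewrite ler_peMl.
nra.
Qed.

(* The charging argument.  [m] is the smallest gain so far, and every element
   of [G] that has become infeasible had value at most [m] until then. *)
Lemma greedy_charge p A r L (B G : {set req}) (x : req -> R) :
  p_system p M -> 0 <= p -> B \in M -> G \subset B ->
  (forall e, 0 <= x e) ->
  greedy rho A r L ->
  (forall e, e \in G -> fits e /\ rho * weight e <= x e) ->
  (forall e, e \in G -> x e <= opt_aug [set e] (on (rev r))) ->
  let T := [set e in G | e |: A \notin M] in
  exists2 m, 0 <= m /\ (forall e, e \in G -> e |: A \in M -> x e <= m)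
    & \sum_(e in T) x e + (p * #|A|%:R - #|T|%:R) * m <= p * L.
Proof.
move=> pM p_ge0 BM GB x_ge0 gA xG; elim: gA => [|{}A {}r {}L a gA IH _ v_gt0 maxv _] xle /=.
  have -> : [set e in G | e |: set0 \notin M] = set0.
    apply/setP => e; rewrite !inE setU0; apply/andP => -[eG /negP[]].
    by apply: M_down BM; rewrite sub1set (subsetP GB).
  (* No gain bounds [m] yet; this crude bound is harmless because its coefficient is 0. *)
  exists (\sum_e x e); first split=> [|e _ _].
  - exact: sumr_ge0.
  - by rewrite (bigD1 e) //= lerDl sumr_ge0.
  - by rewrite big_set0 !cards0 mulr0 subr0 mul0r addr0.
have on_sub : on (rev r) \subset on (rev (a :: r)) by rewrite rev_cons onP.2.
(* Augmentation costs only shrink as the online solution grows, so the bound at the end also holds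
   earlier. *)
have xle' e : e \in G -> x e <= opt_aug [set e] (on (rev r)).
  by move=> eG; apply: le_trans (xle e eG) _; apply: opt_aug_anti.
have [m0 [m0_ge0 m0P] sum_le] := IH xle'.
set v := gain _ a in v_gt0 maxv *.
set T0 := [set e in G | e |: A \notin M] in sum_le.
set T1 := [set e in G | _].
have T01 : T0 \subset T1.
  apply/subsetP => e; rewrite !inE => /andP[-> /=]; apply: contra.
  by apply: M_down; rewrite setUCA subsetUr.
have xm e : e \in G -> e |: A \in M -> x e <= Num.min m0 v.
  move=> eG eA; rewrite le_min m0P //=; have [fe de] := xG e eG.
  have xg : x e <= gain (on (rev r)) e.
    by apply: le_trans (xle' e eG) _; apply: opt_aug_le_gain.
  by apply: le_trans (xg) _; apply: maxv; rewrite /candidate fe eA (le_trans de).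
(* An element of [G] not blocked before the choice of [a] was a candidate then, so its [x] is at
   most the maximal gain [v]. *)
exists (Num.min m0 v).
  split=> [|e eG eaA]; first by rewrite le_min m0_ge0 ltW.
  by apply: xm => //; apply: M_down eaA; rewrite setUCA subsetUr.
(* The coefficient of the potential is nonnegative, so lowering [m0] to the new minimum can only
   decrease the potential. *)
have T0A : #|T0|%:R <= p * #|A|%:R.
  apply: (p_system_blocked pM) => [||e].
  - exact: greedy_M gA.
  - apply: M_down BM; apply: subset_trans GB.
    by apply/subsetP => e; rewrite inE => /andP[].
  - by rewrite inE => /andP[].
have -> : \sum_(e in T1) x e = \sum_(e in T0) x e + \sum_(e in T1 :\: T0) x e.
  by rewrite (big_setID T0) /= (setIidPr T01).
have cardT1 : #|T1|%:R = #|T0|%:R + #|T1 :\: T0|%:R :> R.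
  by rewrite -(cardsID T0 T1) (setIidPr T01) natrD.
have sumD : \sum_(e in T1 :\: T0) x e <= #|T1 :\: T0|%:R * Num.min m0 v.
  rewrite -sum1_card natr_sum mulr_suml; apply: ler_sum => e.
  rewrite !inE => /andP[eT0 /andP[eG _]]; rewrite mul1r; apply: xm => //.
  by rewrite eG /= negbK in eT0.
rewrite cardT1 cardsU1 (gain_notin gA v_gt0) natrD.
have le_m0 : Num.min m0 v <= m0 by rewrite ge_min lexx.
have le_v : Num.min m0 v <= v by rewrite ge_min lexx orbT.
move: (Num.min m0 v) sumD le_m0 le_v => m sumD le_m0 le_v.
have h1 : (p * #|A|%:R - #|T0|%:R) * m <= (p * #|A|%:R - #|T0|%:R) * m0.
  by rewrite ler_wpM2l // subr_ge0.
have h2 : p * m <= p * v by rewrite ler_wpM2l.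
rewrite /=; lra.
Qed.

Lemma greedy_exhausted p A r L (B : {set req}) :
  p_system p M -> 0 <= p -> 0 <= rho -> B \in Omega -> greedy rho A r L ->
  (forall e, candidate rho A (on (rev r)) e -> gain (on (rev r)) e <= 0) ->
  opt B <= rho * q%:R + costs (on (rev r)) + p * L.
Proof.
move=> pM p_ge0 rho_ge0; rewrite inE => /andP[BM BK] gA exhausted.
set S := on (rev r) in exhausted *.
pose x e := opt_aug [set e] S.
pose G := [set e in B | rho * weight e < x e].
have GB : G \subset B by apply/subsetP => e; rewrite inE => /andP[].
have fitsG e : e \in G -> fits e /\ rho * weight e <= x e.
  by rewrite inE => /andP[eB /ltW]; split=> //; apply: knapsack_fits BK eB.
have [//|m [m_ge0 _]] :=
  greedy_charge (x := x) pM p_ge0 BM GB (fun e => opt_aug_ge0 _ _) gA fitsG.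
(* An element of [G] that is not blocked would still be a candidate of positive gain. *)
have blockedG e : e \in G -> e |: A \notin M.
  move=> eG; apply/negP => eA; have [fe de] := fitsG e eG.
  have xg : x e <= gain S e by apply: opt_aug_le_gain.
  have : gain S e <= 0.
    by apply: exhausted; rewrite /candidate fe eA (le_trans de).
  apply/negP; rewrite -ltNge; apply: lt_le_trans xg.
  apply: le_lt_trans (_ : rho * weight e < _).
    by rewrite mulr_ge0 ?weight_ge0.
  by move: eG; rewrite inE => /andP[].
have -> : [set e in G | e |: A \notin M] = G.
  by apply/setP => e; rewrite inE; case eG: (e \in G) => //=; apply: blockedG.
move=> sumG; apply: le_trans (opt_le_sum_aug feasible S B) _.
rewrite (big_setID G) /= (setIidPr GB).
have sumBG : \sum_(e in B :\: G) opt_aug [set e] S <= rho * q%:R.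
  apply: le_trans (_ : rho * weights B <= _); last first.
    by rewrite ler_wpM2l // knapsack_weights.
  have -> : weights B = weights (B :&: G) + weights (B :\: G) by apply: big_setID.
  rewrite mulrDr -[leLHS]add0r lerD //.
    by rewrite mulr_ge0 // sumr_ge0 // => e _; apply: weight_ge0.
  rewrite mulr_sumr; apply: ler_sum => e; rewrite !inE => /andP[+ eB].
  by rewrite eB /= -leNgt.
have GA : #|G|%:R <= p * #|A|%:R.
  apply: (p_system_blocked pM) => [||e]; first exact: greedy_M gA.
    exact: M_down GB BM.
  exact: blockedG.
have : 0 <= (p * #|A|%:R - #|G|%:R) * m by rewrite mulr_ge0 // subr_ge0.
rewrite -/x; lra.
Qed.

End Run.

(** Progress is measured by [l], which the program can compute, while [opt om] is out of its
    reach. *)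
Definition certified l om : Prop :=
  [/\ om \in Omega, 0 <= l & l <= 2 * (a_off * a_on) * opt om].

(** It is quantified over [p], which the program does not receive. The terms [4 * q], [1] and [p]
    account for sparse elements, the online cost and blocked elements. *)
Definition all_bounded l : Prop := forall p B,
  p_system p M -> 0 <= p -> B \in Omega -> opt B <= (4 * q%:R + 1 + p) * l.

Lemma all_bounded_le l l' : l <= l' -> all_bounded l -> all_bounded l'.
Proof.
move=> ll' bl p B pM p_ge0 BO; apply: le_trans (bl p B pM p_ge0 BO) _.
by rewrite ler_wpM2l // !addr_ge0 // mulr_ge0.
Qed.

(** Augmenting [S] for [k] is no dearer than serving [k] from scratch; the remaining factor
    [2 * a_on] is slack. *)
Lemma certified_singleton rho A S k : candidate rho A S k ->
  certified (gain S k) [set k].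
Proof.
move=> /and3P[fk kA _]; split; last 1 first.
- apply: le_trans (gain_le_opt_aug _ _) _.
  have : opt_aug [set k] S <= opt [set k].
    by apply: opt_aug_anti => //; apply: sub0set.
  have := opt_aug_ge0 [set k] S; move: (opt _) (opt_aug _ S) => x y y_ge0 yx.
  have a_off_ge0 : 0 <= a_off by apply: le_trans a_off_ge1.
  have h1 : a_off * y <= a_off * x by rewrite ler_wpM2l.
  have h2 : 0 <= a_off * y by rewrite mulr_ge0.
  have h3 : a_off * x <= a_off * x * a_on by rewrite ler_peMr // (le_trans h2).
  by lra.
- rewrite inE fits_knapsack // andbT; apply: M_down kA.
  by rewrite subsetUl.
- exact: gain_ge0.
Qed.

Definition improve (lom lom' : R * {set req}) : R * {set req} :=
  if lom'.1 <= lom.1 then lom else lom'.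

Lemma improve_ge lom lom' : lom.1 <= (improve lom lom').1.
Proof. by rewrite /improve; case: (leP lom'.1 lom.1) => // /ltW. Qed.

Lemma improve_ge' lom lom' : lom'.1 <= (improve lom lom').1.
Proof. by rewrite /improve; case: (leP lom'.1 lom.1). Qed.

Lemma certified_improve lom lom' : certified lom.1 lom.2 ->
  certified lom'.1 lom'.2 ->
  certified (improve lom lom').1 (improve lom lom').2.
Proof. by rewrite /improve; case: (leP lom'.1 lom.1). Qed.

(** What remains of the first step: the best initial gain has been certified. It later bounds every
    [opt [set e]]. *)
Definition first_step l0 l : Prop := forall e,
  candidate (4 * l0) set0 (on [::]) e -> gain (on [::]) e <= l.

(** The loop has a fixed number of iterations, [i] of which are done. In the last clause, either
    every iteration added an element, or no candidate of positive gain is left, or the value has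
    doubled. *)
Definition run_inv l0 i A r L (lom : R * {set req}) : Prop :=
  [/\ greedy (4 * l0) A r L, certified lom.1 lom.2,
      l0 <= lom.1 /\ L + costs (on (rev r)) <= lom.1,
      i = 0%N /\ r = [::] \/ first_step l0 lom.1
    & [\/ (i <= #|A|)%N,
          forall e, candidate (4 * l0) A (on (rev r)) e ->
            gain (on (rev r)) e <= 0
        | 4 * l0 <= 2 * lom.1]].

Lemma run_inv0 l om : certified l om -> run_inv l 0 set0 [::] 0 (l, om).
Proof.
move=> cert; split=> //=.
- exact: Greedy0.
- by rewrite add0r on_nil_costs; split=> //; case: cert.
- by left.
- by constructor 1.
Qed.

Section Step.
Variables (l0 : R) (i : nat) (A : {set req}) (r : seq req) (L : R).
Variable lom : R * {set req}.
Hypothesis inv : run_inv l0 i A r L lom.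
Let S := on (rev r).

Lemma step_idle :
  (forall e, candidate (4 * l0) A S e -> gain S e <= 0) ->
  run_inv l0 i.+1 A r L lom.
Proof.
move=> idle; case: inv => gA cert le_l fst end_; split=> //; last first.
  by constructor 2.
right; case: fst => // -[_ r0] e; have := idle e.
rewrite /S (greedy_set gA) r0 set_nil => idle0 /idle0 le0; apply: le_trans le0 _.
by case: cert.
Qed.

Variable k : req.
Hypotheses (kc : candidate (4 * l0) A S k) (k_gt0 : 0 < gain S k).
Hypothesis kmax : forall e, candidate (4 * l0) A S e -> gain S e <= gain S k.

Let kmax0 l : gain S k <= l ->
  i = 0%N /\ r = [::] \/ first_step l0 lom.1 -> lom.1 <= l -> first_step l0 l.
Proof.
move=> le_l [[_ r0]|fst] ll e ce; last by apply: le_trans ll; apply: fst.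
apply: le_trans le_l; have := kmax (e := e); rewrite /S r0; apply.
by case: inv => gA _ _ _ _; rewrite (greedy_set gA) r0 set_nil.
Qed.

Lemma step_add : weight k + weights A <= 1 ->
  run_inv l0 i.+1 (k |: A) (k :: r) (L + gain S k)
    (improve lom (L + gain S k + costs (on (rev (k :: r))), k |: A)).
Proof.
move=> le1; case: inv => gA cert [ge_l0 ge_L] fst end_.
have kA := gain_notin gA k_gt0.
have gkA : greedy (4 * l0) (k |: A) (k :: r) (L + gain S k).
  by apply: GreedyS => //; rewrite weightsU1.
set lom' := improve _ _; have ge1 : lom.1 <= lom'.1 by apply: improve_ge.
have ge2 : L + gain S k + costs (on (rev (k :: r))) <= lom'.1.
  exact: (improve_ge' lom (_, k |: A)).
have L_ge0 := greedy_gain_ge0 gA.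
split=> //.
- apply: certified_improve => //; split=> /=.
  + exact: greedy_Omega gkA.
  + by rewrite !addr_ge0 ?costs_ge0 // ltW.
  + exact: greedy_value gkA.
- by split=> //; apply: le_trans ge1.
- right; apply: (kmax0 _ fst) => //; apply: le_trans ge2.
  by rewrite -addrA addrCA lerDl addr_ge0 ?costs_ge0.
- case: end_ => [le_i|idle|le_l].
  + by constructor 1; rewrite cardsU1 kA.
  + by have := idle k kc; rewrite leNgt k_gt0.
  + by constructor 3; apply: le_trans le_l _; rewrite ler_wpM2l.
Qed.

Lemma step_stop : 0 <= l0 -> 1 < weight k + weights A ->
  run_inv l0 i.+1 A r L (improve lom (gain S k, [set k])).
Proof.
move=> l0_ge0 gt1; case: inv => gA cert [ge_l0 ge_L] fst end_.
set lom' := improve _ _; have ge1 : lom.1 <= lom'.1 by apply: improve_ge.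
have ge2 : gain S k <= lom'.1 by apply: (improve_ge' lom (_, [set k])).
split=> //.
- by apply: certified_improve => //=; apply: certified_singleton kc.
- by split; apply: le_trans ge1.
- by right; apply: (kmax0 _ fst).
(* The weights sum to more than 1 and all densities are at least [4 * l0], so [4 * l0] is at most
   [L + gain S k]. Both summands are at most the new value. *)
- constructor 3; have dens := greedy_density gA; have [_ _ densk] := and3P kc.
  have c_ge0 := costs_ge0 (on (rev r)); move: densk; rewrite -/S => densk.
  have : 4 * l0 <= 4 * l0 * (weight k + weights A).
    by rewrite ler_peMr ?mulr_ge0 // ltW.
  by rewrite mulrDr; lra.
Qed.

End Step.

Lemma run_result l0 A r L lom : 0 <= l0 ->
  run_inv l0 (nreq C) A r L lom ->
  [/\ certified lom.1 lom.2, l0 <= lom.1,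
      forall e, [set e] \in Omega -> opt [set e] <= (4 * q%:R + 1) * lom.1
    & all_bounded lom.1 \/ 2 * l0 <= lom.1].
Proof.
move=> l0_ge0 [gA cert [ge_l0 ge_L] fst end_]; have [_ l_ge0 _] := cert.
have L_ge0 := greedy_gain_ge0 gA; have c_ge0 := costs_ge0 (on (rev r)).
have rho_ge0 : 0 <= 4 * l0 by rewrite mulr_ge0.
have q_ge0 : 0 <= q%:R :> R by [].
have ql : q%:R * l0 <= q%:R * lom.1 by rewrite ler_wpM2l.
have ql0 : 0 <= q%:R * l0 by rewrite mulr_ge0.
split=> // [e|].
  (* A run without any iteration would mean [nreq C = 0], which [e] refutes. *)
  rewrite inE => /andP[eM eK]; case: fst => [[n0]|fst].
    by have := ltn_ord e; rewrite {2}n0.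
  have fe : fits e by apply: knapsack_fits eK _; rewrite // inE.
  have opt_gain : opt [set e] <= gain (on [::]) e.
    apply: le_trans (opt_le_sum_aug feasible (on [::]) _) _.
    by rewrite on_nil_costs add0r big_set1 opt_aug_le_gain.
  apply: le_trans opt_gain _.
  (* A dense [e] was a candidate in the first step; a sparse one gains at most [4 * l0 * q]. *)
  case: (leP (4 * l0 * weight e) (gain (on [::]) e)) => [de|/ltW le_e].
    have := fst e; rewrite /candidate fe setU0 eM de => /(_ isT) le_l.
    by apply: le_trans le_l _; rewrite mulrDl mul1r; lra.
  apply: le_trans le_e _.
  have : weights [set e] <= q%:R by apply: knapsack_weights.
  rewrite /weights big_set1 => /(ler_wpM2l rho_ge0); rewrite mulrDl mul1r.
  by move=> h; apply: le_trans h _; lra.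
have exhausted : (forall e, candidate (4 * l0) A (on (rev r)) e ->
    gain (on (rev r)) e <= 0) -> all_bounded lom.1.
  move=> idle p B pM p_ge0 BO.
  apply: le_trans (greedy_exhausted pM p_ge0 rho_ge0 BO gA idle) _.
  have : p * L <= p * lom.1 by rewrite ler_wpM2l //; lra.
  by rewrite !mulrDl mul1r; lra.
case: end_ => [le_n|idle|le_l].
(* After [nreq C] additions every requirement is covered and has gain 0. *)
- left; apply: exhausted => e _; rewrite (gain_covered gA) //.
  suff -> : A = setT by rewrite inE.
  by apply/eqP; rewrite eqEcard subsetT cardsT card_ord.
- by left; apply: exhausted.
- by right; lra.
Qed.

(** The guard is there because the initial value is 0: the first run gives the inequality for
    exponent 1, and each later run doubles [l] unless [all_bounded] holds. *)
Definition main_inv i l om : Prop :=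
  certified l om /\
  (all_bounded l \/
   ((0 < i)%N -> forall e, [set e] \in Omega ->
     2 ^+ i * opt [set e] <= 2 * (4 * q%:R + 1) * l)).

Lemma main_inv0 : main_inv 0 0 set0.
Proof.
split; last by right.
split=> //; last by rewrite opt_set0 mulr0.
by rewrite inE M0 inE; apply/forallP => j; rewrite big_set0.
Qed.

Lemma main_inv_step i l0 om0 A r L lom :
  main_inv i l0 om0 -> run_inv l0 (nreq C) A r L lom ->
  main_inv i.+1 lom.1 lom.2.
Proof.
move=> [[_ l0_ge0 _] bounded] inv.
have [cert ge_l0 opt1 run] := run_result l0_ge0 inv; split=> //.
case: run => [|ge2]; first by left.
case: bounded => [bl|bl]; first by left; apply: all_bounded_le bl.
right=> _ e eO; case: i bl => [_|i /(_ isT e eO) le_l].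
  by rewrite expr1 -mulrA ler_wpM2l // opt1.
rewrite exprS -mulrA mulrA [2 * 2 ^+ _]mulrC.
have : 2 * (4 * q%:R + 1) * (2 * l0) <= 2 * (4 * q%:R + 1) * lom.1.
  by rewrite ler_wpM2l // mulr_ge0 // addr_ge0 // mulr_ge0.
by lra.
Qed.

Lemma main_result p l om B :
  main_inv (nreq C) l om -> p_system p M -> 0 <= p -> B \in Omega ->
  opt B <= 8 * (p + 1) * (q%:R + 1) * a_off * a_on * opt om.
Proof.
move=> [[omO l_ge0 l_le] bounded] pM p_ge0 BO.
have q_ge0 : 0 <= q%:R :> R by [].
have main : opt B <= (4 * q%:R + 1 + p) * l.
  case: bounded => [|bl]; first exact.
  case: (set_0Vmem B) => [->|[e0 e0B]].
    by rewrite opt_set0 mulr_ge0 // !addr_ge0 // mulr_ge0.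
  have n_gt0 : (0 < nreq C)%N by apply: leq_ltn_trans (ltn_ord e0).
  have opt_sum : opt B <= \sum_(e in B) opt [set e].
    by have := opt_le_sum_aug feasible set0 B; rewrite costs0 add0r.
  have le_e e : e \in B -> 2 ^+ (nreq C) * opt [set e] <= 2 * (4 * q%:R + 1) * l.
    move=> eB; apply: bl => //; move: BO; rewrite !inE => /andP[BM BK].
    rewrite (M_down _ BM) ?sub1set //=.
    have := fits_knapsack (knapsack_fits w_ge0 (_ : B \in knapsack w b) eB).
    by rewrite !inE; apply.
  (* [B] has at most [2 ^ (nreq C - 1)] elements, so the exponential factor gained in [nreq C] runs
     pays for summing over its singletons. *)
  have le_n : (2 * #|B| <= 2 ^ nreq C)%N.
    have : (#|B| <= nreq C)%N by rewrite -[leqRHS]card_ord max_card.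
    move: n_gt0; move: #|B| => m; case: (nreq C) => // n _ le_B.
    by rewrite expnS leq_mul2l /=; apply: leq_trans le_B (ltn_expl _ _).
  have : 2 ^+ nreq C * opt B <= 2 ^+ nreq C * ((4 * q%:R + 1) * l).
    apply: le_trans (_ : \sum_(e in B) 2 * (4 * q%:R + 1) * l <= _).
      apply: le_trans (_ : 2 ^+ nreq C * \sum_(e in B) opt [set e] <= _).
        by rewrite ler_wpM2l // exprn_ge0.
      by rewrite mulr_sumr; apply: ler_sum.
    have {le_n} : 2 * #|B|%:R <= 2 ^+ nreq C :> R.
      by rewrite -natrM -natrX ler_nat.
    have x_ge0 : 0 <= (4 * q%:R + 1) * l.
      by rewrite mulr_ge0 // addr_ge0 // mulr_ge0.
    move=> /(ler_wpM2r x_ge0); apply: le_trans.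
    by rewrite sumr_const -[leLHS]mulr_natl; lra.
  rewrite ler_pM2l ?exprn_gt0 // => /le_trans; apply.
  by rewrite ler_wpM2r // lerDl.
apply: le_trans main _; set c := 4 * _ + 1 + p.
have c_ge0 : 0 <= c by rewrite !addr_ge0 // mulr_ge0.
apply: le_trans (ler_wpM2l c_ge0 l_le) _.
have y_ge0 : 0 <= a_off * a_on * opt om.
  rewrite !mulr_ge0 ?opt_aug_ge0 //.
    exact: le_trans a_off_ge1.
  exact: le_trans a_on_ge1.
(* Source of the constant 8: it must absorb [2 * 4 * q]. *)
have le_c : 2 * c <= 8 * (p + 1) * (q%:R + 1).
  have := mulr_ge0 p_ge0 q_ge0; rewrite /c; lra.
have := ler_wpM2r y_ge0 le_c; lra.
Qed.

End Greedy.

(** * Programs *)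

Section ListPrograms.
Variables (R : realFieldType) (O : data R -> data R -> Prop).

Lemma enc_nat_nth k i : nth Nil (nseq k (@Nil R)) i = Nil.
Proof. by rewrite nth_nseq if_same. Qed.

(** The accumulator turns to [Nil] at the first constraint that the element violates and then stays
    so. *)
Definition Weigh :=
  Case (Var 0) PNil PNil
    (Let (PCons (Var 1) (Const 0))
      (Fold
        (Case (Var 3) PNil
          (Case (Var 0) PNil PNil
            (Let (Let (PCons (Var 7) (Var 1)) SplitAt)
              (Case (Var 0) PNil PNil
                (Case (Var 1) PNil PNil
                  (IfLe (Var 0) (Var 5)
                    (Arith Add (Var 10) (Arith Div (Var 0) (Var 5)))
                    PNil)))))
          PNil))).

Definition enc_weight n q (w : 'I_q -> 'I_n -> R) (b : 'I_q -> R) e : data R :=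
  if fits w b e then Num (weight w b e) else Nil.

Lemma Weigh_ok n q (w : 'I_q -> 'I_n -> R) (b : 'I_q -> R) (e : 'I_n) N :
  (n <= N)%N -> (q <= N)%N ->
  outputs_within O Weigh (Cons (enc_nat R e) (enc_knapsack w b))
    (enc_weight w b e) (N * (21 * N + 100) + 30)%N.
Proof.
move=> le_n le_q; rewrite /Weigh.
pose item j := Cons (Num (b j)) (enc_vec (w j)).
set F := Case (Var 3) _ _ _.
have [||i x|y ey] := @ev_fold R (fun i x => x =
    if all (fun j => w j e <= b j) (take i (enum 'I_q))
    then Num (\sum_(j <- take i (enum 'I_q)) w j e / b j) else Nil) O
  [:: enc_nat R e; enc_knapsack w b; Cons (enc_nat R e) (enc_knapsack w b)]
  F [seq item j | j <- enum 'I_q] (Num 0) N (21 * N + 85)%N.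
- by rewrite size_map -cardE card_ord.
- by rewrite take0 big_nil.
- rewrite size_map -cardE card_ord => lt_i -> tl l st.
  pose j := Ordinal lt_i.
  have nthj : nth j (enum 'I_q) i = j by apply: val_inj; rewrite /= nth_enum_ord.
  have enum_i : (i < size (enum 'I_q))%N by rewrite -cardE card_ord.
  rewrite (nth_map j) // nthj (take_nth j) // nthj.
  rewrite all_rcons -cats1 big_cat big_seq1 /= -/j.
  case: all; last first.
    by rewrite andbF; eexists; last reflexivity; rewrite /F; ev_run; lia.
  have e_w : (e < size [seq Num (w j k) | k <- enum 'I_n])%N.
    by rewrite size_map -cardE card_ord.
  rewrite andbT; eexists; last reflexivity.
  rewrite /F; eapply ev_le.
    do 2 ev_step; eapply ev_let.
      eapply ev_call; first by ev_auto.
      apply: (@SplitAt_ok R O e [seq Num (w j k) | k <- enum 'I_n] N).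
        exact: ltnW.
      exact: leq_trans (ltnW (ltn_ord e)) le_n.
    rewrite (drop_nth Nil e_w) (nth_map e) -?cardE ?card_ord //.
    rewrite nth_ord_enum; ev_step; ev_step; ev_step.
    1, 2: by ev_step.
    (* Both outcomes of the comparison must obey one bound, so it is fixed before the case
       distinction. *)
    instantiate (1 := 6%N).
    by case: (w j e <= b j); ev_run.
  lia.
rewrite size_map take_oversize // => ye.
have <- : y = enc_weight w b e.
  rewrite ye /enc_weight /fits /weight big_enum /=; congr (if _ then _ else _).
  by apply/allP/forallP => [h j|h j _]; apply: h; rewrite ?mem_enum.
eapply ev_le; first by ev_step; eapply ev_let; [ev_auto|exact: ey].
lia.
Qed.

(** The fold runs over the costs; the bits are consumed in parallel from inside the accumulator. *)
Definition Costs :=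
  Case (Var 0) PNil PNil
    (Let (Let (PCons (Var 0) (PCons (Var 1) (Const 0)))
           (Fold
             (Case (Var 3) PNil PNil
               (Case (Var 0) PNil PNil
                 (Case (Var 0) (PCons (Var 1) (Var 3)) PNil
                   (PCons (Var 3) (Arith Add (Var 5) (Var 6))))))))
      (Case (Var 0) PNil PNil (Var 1))).

Lemma Costs_ok (C : covering R) (A : {set 'I_(nelt C)}) N :
  (nelt C <= N)%N ->
  outputs_within O Costs (Cons (enc_vec (@cost R C)) (enc_set R A))
    (Num (costs A)) (N * 40 + 40)%N.
Proof.
move=> le_n; rewrite /Costs; set F := Case (Var 3) _ _ _.
set m := nelt C in A le_n *.
pose bits := [seq enc_bool R (i \in A) | i <- enum 'I_m].
have [||i x|y ey] := @ev_fold R (fun i x => x =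
    Cons (enc_list (drop i bits))
         (Num (\sum_(e <- take i (enum 'I_m) | e \in A) cost e))) O
  [:: enc_vec (@cost R C); enc_set R A; Cons (enc_vec (@cost R C)) (enc_set R A)]
  F [seq Num (cost e) | e <- enum 'I_m] (Cons (enc_set R A) (Num 0)) N 20.
- by rewrite size_map -cardE card_ord.
- by rewrite take0 big_nil drop0.
- rewrite size_map -cardE card_ord => lt_i -> tl l st.
  pose j := Ordinal lt_i.
  have nthj : nth j (enum 'I_m) i = j by apply: val_inj; rewrite /= nth_enum_ord.
  have enum_i : (i < size (enum 'I_m))%N by rewrite -cardE card_ord.
  rewrite (nth_map j) // nthj (take_nth j) // nthj.
  rewrite -cats1 big_cat big_cons big_nil /= -/j.
  have i_bits : (i < size bits)%N by rewrite size_map.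
  rewrite (drop_nth Nil i_bits) (nth_map j) // nthj /F.
  case: (j \in A) => /=; eexists; [|reflexivity| |reflexivity].
    by rewrite addr0; ev_run.
  by rewrite addr0; ev_run.
rewrite size_map take_oversize // => ye.
have {}ye : y = Cons (enc_list (drop (size (enum 'I_m)) bits)) (Num (costs A)).
  by rewrite ye big_enum_cond.
rewrite ye in ey.
eapply ev_le.
  ev_step; eapply ev_let; last by ev_auto.
  by eapply ev_let; [ev_auto|exact: ey].
lia.
Qed.

Definition Improve :=
  Case (Var 0) PNil PNil
    (Case (Var 0) PNil PNil
      (Case (Var 3) PNil PNil
        (IfLe (Var 0) (Var 2) (Var 4) (Var 5)))).

Definition enc_value n (lom : R * {set 'I_n}) : data R :=
  Cons (Num lom.1) (enc_set R lom.2).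

Lemma Improve_ok n (lom lom' : R * {set 'I_n}) :
  outputs_within O Improve (Cons (enc_value lom) (enc_value lom'))
    (enc_value (if lom'.1 <= lom.1 then lom else lom')) 20.
Proof.
rewrite /Improve; eapply ev_le.
  do 4 ev_step; [by ev_auto | by ev_auto | instantiate (1 := 1%N)].
  by case: leP => _; ev_auto.
by [].
Qed.

End ListPrograms.

Section Programs.
Variables Poff Pon : prog.

(* On [(inst, (k, S))], the cost of the augmentation of [S] for [k]. *)
Definition Gain :=
  Case (Var 0) PNil PNil (Case (Var 1) PNil PNil
  (Case (Var 2) PNil PNil (Case (Var 1) PNil PNil
    (Let (Let (PCons (Var 6)
                (PCons (Var 5) (Let (PCons (Var 4) (Var 0)) SetBit)))
           Poff)
      (Let (PCons (Var 3) (Var 0)) Costs))))).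

(* On [((inst, ks), (rho, (A, S)))], a candidate [(k, (gain, weight))] of
   maximal gain; a gain of [0] means that there is no candidate of positive
   gain. *)
Definition Select :=
  Case (Var 0) PNil PNil (Case (Var 0) PNil PNil
  (Case (Var 3) PNil PNil (Case (Var 1) PNil PNil
  (Case (Var 4) PNil PNil (Case (Var 1) PNil PNil
    (Let (Let (PCons (Var 0)
                (PCons PNil (PCons PNil (PCons (Const 0) (Const 0)))))
           (Fold
             (Case (Var 3) PNil PNil
               (PCons (PCons PNil (Var 0))
                 (Let (Let (PCons (Var 0) (Var 16)) Weigh)
                   (Case (Var 0) (Var 2)
                     (Case (Ask (Let (PCons (Var 1) (Var 12)) SetBit))
                       (Var 2)
                       PNil
                       (Let (Let (PCons (Var 18) (PCons (Var 3) (Var 15))) Gain)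
                         (Case (Var 5) PNil PNil
                           (Case (Var 1) PNil PNil
                             (IfLe (Var 4) (Var 0) (Var 9)
                               (IfLe (Arith Mul (Var 21) (Var 7)) (Var 4)
                                 (PCons (Var 8) (PCons (Var 4) (Var 7)))
                                 (Var 9)))))))
                     PNil))))))
      (Case (Var 0) PNil PNil (Var 1)))))))).

(* One greedy step on [((inst, ks), (rho, (state, best)))], where [state] is
   [(A, (r, (S, (weights A, L))))] and [best] is the most valuable certified
   set so far with its value.  If the selected element does not fit, the state
   does not change, so all later steps are idle. *)
Definition Step :=
  Case (Var 0) PNil PNil (Case (Var 1) PNil PNil
  (Case (Var 1) PNil PNil (Case (Var 0) PNil PNil
  (Case (Var 1) PNil PNil (Case (Var 1) PNil PNil
  (Case (Var 1) PNil PNil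
    (Let (Let (PCons (Var 12) (PCons (Var 10) (PCons (Var 6) (Var 2)))) Select)
      (Case (Var 0) PNil PNil (Case (Var 1) PNil PNil
      (Case (Var 17) PNil PNil (Case (Var 0) PNil PNil
      (Case (Var 1) PNil PNil
        (IfLe (Var 6) (Const 0) (Var 22)
          (IfLe (Arith Add (Var 7) (Var 11)) (Const 1)
            (Let (PCons (Var 8) (Var 15))
            (Let (Let (PCons (Var 5) (Let (PCons (Var 0) PNil) Catrev)) Pon)
            (Let (Let (PCons (Var 10) (Var 19)) SetBit)
            (Let (Arith Add (Var 15) (Var 9))
              (PCons
                (PCons (Var 1) (PCons (Var 3) (PCons (Var 2)
                  (PCons (Arith Add (Var 11) (Var 15)) (Var 0)))))
                (Let (PCons (Var 24)
                       (PCons (Arith Add (Var 0)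
                                (Let (PCons (Var 6) (Var 2)) Costs))
                         (Var 1)))
                  Improve))))))
            (PCons (Var 19)
              (Let (PCons (Var 20)
                     (PCons (Var 6) (Let (PCons (Var 8) (Var 0)) SetBit)))
                Improve)))))))))))))))).

(* On [((inst, ks), best)], a greedy run whose density threshold is 4 times
   the value of [best]. *)
Definition Run :=
  Case (Var 0) PNil PNil (Case (Var 0) PNil PNil
  (Case (Var 0) PNil PNil (Case (Var 1) PNil PNil
  (Case (Var 7) PNil PNil
    (Let (Arith Mul (Const 4) (Var 0))
    (Let (Let (PCons (Var 7) PNil) Pon)
    (Let (Let (PCons (Var 4)
                (PCons (PCons (Var 4) (PCons PNil
                         (PCons (Var 0) (PCons (Const 0) (Const 0)))))
                  (Var 11)))
           (Fold (Let (PCons (Var 15) (PCons (Var 6) (Var 3))) Step)))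
      (Case (Var 0) PNil PNil (Var 1))))))))).

(** The unary number [nreq C] drives the fold over the runs and is also the encoding of the initial
    empty set. *)
Definition Main :=
  Case (Var 0) PNil PNil (Case (Var 0) PNil PNil (Case (Var 1) PNil PNil
    (Let (Let (PCons (Var 0) (PCons (Const 0) (Var 0)))
           (Fold (Let (PCons (Var 11) (Var 3)) Run)))
      (Case (Var 0) PNil PNil (Var 1))))).

End Programs.

(** * Correctness and running time of the programs *)

Section MainOk.
Variables (R : realFieldType) (C : covering R) (d : data R).
Notation req := 'I_(nreq C).
Notation elts := {set 'I_(nelt C)}.
Variables (a_off a_on : R) (off : elts -> {set req} -> elts).
Variables (on : seq req -> elts).
Hypothesis offP : forall S X, augmentation a_off X S (off S X).
Hypotheses (onP : online_algorithm on) (on_comp : competitive a_on on).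
Hypotheses (a_off_ge1 : 1 <= a_off) (a_on_ge1 : 1 <= a_on).
Variables (q : nat) (w : 'I_q -> req -> R) (b : 'I_q -> R).
Hypotheses (w_ge0 : forall j e, 0 <= w j e) (b_ge0 : forall j, 0 <= b j).
Variables (M : {set {set req}}).
Hypothesis M0 : set0 \in M.
Hypothesis M_down : forall A B : {set req}, A \subset B -> B \in M -> A \in M.

Variables (Poff Pon : prog) (N Toff Ton : nat).
Hypotheses (le_elt : (nelt C <= N)%N) (le_req : (nreq C <= N)%N).
Hypothesis le_q : (q <= N)%N.

Notation inst := (enc_covering C d).
Notation O := (membership_oracle (R := R) M).
Notation weight := (weight w b).
Notation weights := (weights w b).
Notation gain := (gain off).
Notation cand := (candidate off w b M).

Hypothesis PoffP : forall S X,
  outputs_within O Poff (Cons inst (Cons (enc_set R S) (enc_set R X)))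
    (enc_set R (off S X)) Toff.
Hypothesis PonP : forall s, (size s <= nreq C)%N ->
  outputs_within O Pon (Cons inst (enc_seq R s)) (enc_set R (on s)) Ton.

Let ks := enc_knapsack w b.

(** A false bit is [Nil], as is a unary digit. So the instance itself supplies the empty set to the
    programs. *)
Lemma enc_set0 n : enc_nat R n = enc_set R (set0 : {set 'I_n}).
Proof.
rewrite /enc_nat /enc_set -[n in nseq n]size_enum_ord.
by elim: (enum 'I_n) => //= i s ->; rewrite inE.
Qed.

Lemma SetBit1_ok (k : req) :
  outputs_within O SetBit (Cons (enc_nat R k) (enc_nat R (nreq C)))
    (enc_set R [set k]) (nreq C * 40 + 60)%N.
Proof. by rewrite (enc_set0 (nreq C)) -[[set k]]setU0; apply: SetBit_ok. Qed.

Lemma Rev_ok (s : seq req) : (size s <= N)%N ->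
  outputs_within O Catrev (Cons (enc_seq R s) Nil) (enc_seq R (rev s))
    (N * 15 + 10)%N.
Proof.
move=> le_s; rewrite /enc_seq map_rev.
by apply: (@Catrev_ok _ _ _ [::]); rewrite size_map.
Qed.

Lemma Gain_ok (k : req) S :
  outputs_within O (Gain Poff)
    (Cons inst (Cons (enc_nat R k) (enc_set R S))) (Num (gain S k))
    (80 * N + Toff + 200)%N.
Proof.
rewrite /Gain; eapply ev_le.
  do 4 ev_step; eapply ev_let.
    eapply ev_call; last eapply PoffP.
    do 2 ev_step; first by ev_auto.
    by eapply ev_call; [ev_auto | exact: SetBit1_ok].
  by eapply ev_call; [ev_auto | exact: Costs_ok].
lia.
Qed.


(** Only the first [i] requirements have been examined. While [v] is 0, [k] and [u] are
    placeholders. *)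
Definition selected rho A S i (k : nat) v u : Prop :=
  [/\ 0 <= v,
      forall e : req, (e < i)%N -> cand rho A S e -> gain S e <= v
    & 0 < v -> exists e : req,
        [/\ k = e, cand rho A S e, v = gain S e & u = weight e]].

Let Tselect := (N * (N * (21 * N + 100) + 120 * N + Toff + 400) + 100)%N.

Lemma Select_ok rho (A : {set req}) S : exists k v u,
  selected rho A S (nreq C) k v u /\
  outputs_within O (Select Poff)
    (Cons (Cons inst ks) (Cons (Num rho) (Cons (enc_set R A) (enc_set R S))))
    (Cons (enc_nat R k) (Cons (Num v) (Num u))) Tselect.
Proof.
pose enc i k v u : data R :=
  Cons (enc_nat R i) (Cons (enc_nat R k) (Cons (Num v) (Num u))).
rewrite /Select; set F := Case (Var 3) _ _ (PCons _ _).
have [||i x|y ey] := @ev_fold R (fun i x => exists k v u,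
    selected rho A S i k v u /\ x = enc i k v u) O
  [:: enc_nat R (nreq C); d; enc_vec (@cost R C); Cons (enc_nat R (nreq C)) d;
      enc_set R A; enc_set R S; Num rho; Cons (enc_set R A) (enc_set R S);
      inst; ks; Cons inst ks;
      Cons (Num rho) (Cons (enc_set R A) (enc_set R S));
      Cons (Cons inst ks) (Cons (Num rho) (Cons (enc_set R A) (enc_set R S)))]
  F (nseq (nreq C) Nil) (enc 0%N 0%N 0 0) N
  (N * (21 * N + 100) + 120 * N + Toff + 380)%N.
- by rewrite size_nseq.
- by exists 0%N, 0, 0; split=> //; split=> //; rewrite ltxx.
- rewrite size_nseq => lt_i [k [v [u [[v_ge0 vmax vk] ->]]]] tl l st.
  pose e := Ordinal lt_i; rewrite enc_nat_nth /F.
  have skip : ~~ cand rho A S e \/ gain S e <= v -> selected rho A S i.+1 k v u.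
    move=> small; split=> // e'; rewrite ltnS leq_eqVlt => /orP[/eqP eq_e|].
      have -> : e' = e by apply: val_inj.
      by case: small => // /negP nc /nc.
    exact: vmax.
  have ask : ev O [:: enc_weight w b e, enc_nat R i,
    Cons (enc_nat R k) (Cons (Num v) (Num u)), Nil, tl, l, enc i k v u, st,
      enc_nat R (nreq C), d, enc_vec (@cost R C), Cons (enc_nat R (nreq C)) d,
      enc_set R A, enc_set R S, Num rho, Cons (enc_set R A) (enc_set R S),
      inst, ks, Cons inst ks,
      Cons (Num rho) (Cons (enc_set R A) (enc_set R S)) &
      [:: Cons (Cons inst ks)
            (Cons (Num rho) (Cons (enc_set R A) (enc_set R S)))]]
     (Ask (Let (PCons (Var 1) (Var 12)) SetBit))
     (enc_bool R (e |: A \in M)) (40 * N + 70)%N.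
    apply: ev_le.
      apply: ev_ask; last by exists (e |: A).
      by eapply ev_call; [ev_auto | exact: (SetBit_ok O e A)].
    by clear -le_req le_elt; lia.
  have weigh_e := Weigh_ok O w b e le_req le_q.
  case fe: (fits w b e); last first.
    exists (enc i.+1 k v u); last first.
      by exists k, v, u; split=> //; apply: skip; left; rewrite /candidate fe.
    eapply ev_le.
      ev_step; ev_step; first by ev_auto.
      eapply ev_let; first by eapply ev_call; [ev_auto | exact: weigh_e].
      by rewrite {1}/enc_weight fe; ev_auto.
    by clear -le_req le_elt; lia.
  case eM: (e |: A \in M); last first.
    exists (enc i.+1 k v u); last first.
      by exists k, v, u; split=> //; apply: skip; left; rewrite /candidate fe eM.
    eapply ev_le.
      ev_step; ev_step; first by ev_auto.
      eapply ev_let; first by eapply ev_call; [ev_auto | exact: weigh_e].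
      rewrite {1}/enc_weight fe; ev_step.
      move: ask; rewrite /enc_weight fe eM => ask.
      by eapply ev_case_nil; [exact: ask | ev_auto].
    by clear -le_req le_elt; lia.
  have candE : cand rho A S e = (rho * weight e <= gain S e).
    by rewrite /candidate fe eM.
  pose kvu := if gain S e <= v then (k, v, u) else
    if rho * weight e <= gain S e then (i, gain S e, weight e) else (k, v, u).
  exists (enc i.+1 kvu.1.1 kvu.1.2 kvu.2); last first.
    exists kvu.1.1, kvu.1.2, kvu.2; split=> //; rewrite /kvu.
    case: (leP (gain S e) v) => [le_v|gt_v]; first by apply: skip; right.
    case: (leP (rho * weight e) (gain S e)) => [de|gt_e]; last first.
      by apply: skip; left; rewrite candE -ltNge.
    split=> [|e'|_] /=; first exact: gain_ge0.
      rewrite ltnS leq_eqVlt => /orP[/eqP eq_e _|lt_e ce].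
        by have -> : e' = e by apply: val_inj.
      by apply: le_trans (ltW gt_v); apply: vmax.
    by exists e; rewrite candE.
  eapply ev_le.
    ev_step; ev_step; first by ev_auto.
    eapply ev_let; first by eapply ev_call; [ev_auto | exact: weigh_e].
    move: ask; rewrite /enc_weight fe eM => ask; ev_step.
    eapply ev_case_cons; first exact: ask.
    eapply ev_let; first by eapply ev_call; [ev_auto | exact: (Gain_ok e S)].
    ev_step; ev_step; ev_step; [by ev_step | by ev_step | instantiate (1 := 20%N)].
    rewrite /kvu; case: (gain S e <= v); first by ev_run.
    eapply ev_le.
      ev_step; [by ev_auto | by ev_step | instantiate (1 := 10%N)].
      by case: (_ <= gain S e); ev_run.
    by [].
  by clear -le_req le_elt; lia.
rewrite size_nseq => -[k [v [u [sel ye]]]]; rewrite ye in ey.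
exists k, v, u; split=> //; eapply ev_le.
  do 6 ev_step; eapply ev_let; last by ev_auto.
  by eapply ev_let; [ev_auto | exact: ey].
rewrite /Tselect; nia.
Qed.

Notation run_inv := (run_inv a_off a_on off on w b M).
Notation main_inv := (main_inv a_off a_on w b M).

Definition enc_state (A : {set req}) (r : seq req) L (lom : R * {set req}) :=
  Cons (Cons (enc_set R A) (Cons (enc_seq R r) (Cons (enc_set R (on (rev r)))
         (Cons (Num (weights A)) (Num L)))))
    (enc_value lom).

Let Tstep := (Tselect + 300 * N + Ton + 1000)%N.

Lemma Step_ok l0 i A r L lom : 0 <= l0 ->
  run_inv l0 i A r L lom ->
  exists A' r' L' lom', run_inv l0 i.+1 A' r' L' lom' /\
    outputs_within O (Step Poff Pon)
      (Cons (Cons inst ks) (Cons (Num (4 * l0)) (enc_state A r L lom)))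
      (enc_state A' r' L' lom') Tstep.
Proof.
move=> l0_ge0 inv; have [gA _ _ _ _] := inv.
have [k [v [u [[v_ge0 vmax vk] sel_ok]]]] := Select_ok (4 * l0) A (on (rev r)).
case: (leP v 0) => [v_le0|v_gt0].
  exists A, r, L, lom; split.
    apply: step_idle => // e ce; apply: le_trans v_le0.
    exact: vmax (ltn_ord e) ce.
  rewrite /Step; eapply ev_le.
    do 7 ev_step; eapply ev_let.
      by eapply ev_call; [ev_auto | exact: sel_ok].
    do 5 ev_step; ev_step; [by ev_step | by ev_step | instantiate (1 := 1%N)].
    by rewrite v_le0; ev_auto.
  by clear -le_req le_elt; rewrite /Tstep; lia.
have [e [ke ce ve ue]] := vk v_gt0; rewrite {}ke {}ve {}ue in v_gt0 vmax sel_ok.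
have emax e' : cand (4 * l0) A (on (rev r)) e' ->
    gain (on (rev r)) e' <= gain (on (rev r)) e.
  exact: vmax (ltn_ord e').
case: (leP (weight e + weights A) 1) => [le1|gt1].
  have inv' := step_add offP onP on_comp a_off_ge1 w_ge0 b_ge0 M0
    inv ce v_gt0 emax le1.
  do 4 eexists; split; first exact: inv'.
  (* The choices of a run are distinct, so the input of the online program stays short. *)
  have size_r : (size (rev (e :: r)) <= nreq C)%N.
    have [gA' _ _ _ _] := inv'; rewrite size_rev.
    rewrite (greedy_size offP onP a_off_ge1 gA') -[leqRHS]card_ord.
    exact: max_card.
  rewrite /enc_state (weightsU1 _ _ (gain_notin offP onP a_off_ge1 gA v_gt0)).
  rewrite /Step; eapply ev_le.
    do 7 ev_step; eapply ev_let.
      by eapply ev_call; [ev_auto | exact: sel_ok].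
    do 6 ev_step;
      [by ev_step | by ev_step | instantiate (1 := (320 + N * 110 + Ton)%N)].
    rewrite leNgt v_gt0 /=; eapply ev_le.
      ev_step; [by ev_auto | by ev_step | instantiate (1 := (300 + N * 110 + Ton)%N)].
      rewrite le1; eapply ev_le.
        eapply ev_let; first by ev_auto.
        eapply ev_let.
          eapply ev_call; last exact: (PonP size_r).
          ev_step; first by ev_auto.
          eapply ev_call; first by ev_auto.
          by apply: (Rev_ok (s := e :: r)); rewrite -size_rev (leq_trans size_r).
        eapply ev_let; first by eapply ev_call; [ev_auto | exact: SetBit_ok].
        eapply ev_let; first by ev_auto.
        ev_step; first by ev_auto.
        eapply ev_call; last by exact: (Improve_ok O lom (_, e |: A)).
        ev_step; first by ev_auto.
        ev_step; last by ev_auto.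
        eapply ev_arith; [by ev_auto | | reflexivity].
        by eapply ev_call; [ev_auto | exact: Costs_ok].
      by clear -le_req le_elt; lia.
    by clear -le_req le_elt; lia.
  by clear -le_req le_elt; rewrite /Tstep; lia.
have inv' := step_stop offP onP a_off_ge1 a_on_ge1 M_down inv ce emax l0_ge0 gt1.
do 4 eexists; split; first exact: inv'.
rewrite /Step; eapply ev_le.
  do 7 ev_step; eapply ev_let.
      by eapply ev_call; [ev_auto | exact: sel_ok].
  do 6 ev_step;
    [by ev_step | by ev_step | instantiate (1 := (100 + N * 40 + 60)%N)].
  rewrite leNgt v_gt0 /=; eapply ev_le.
    ev_step; [by ev_auto | by ev_step | instantiate (1 := (50 + N * 40 + 60)%N)].
    rewrite leNgt gt1 /=; eapply ev_le.
      ev_step; first by ev_auto.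
      eapply ev_call; last by exact: (Improve_ok O lom (_, [set e])).
      do 2 (ev_step; first by ev_auto).
      by eapply ev_call; [ev_auto | exact: SetBit1_ok].
    by clear -le_req le_elt; lia.
  by clear -le_req le_elt; lia.
by clear -le_req le_elt; rewrite /Tstep; lia.
Qed.

Let Trun := (N * (Tstep + 40) + Ton + 300)%N.

Lemma Run_ok i lom : main_inv i lom.1 lom.2 ->
  exists lom', main_inv i.+1 lom'.1 lom'.2 /\
    outputs_within O (Run Poff Pon)
      (Cons (Cons inst ks) (enc_value lom)) (enc_value lom') Trun.
Proof.
case: lom => l om inv; have [cert _] := inv; have [_ l_ge0 _] := cert.
rewrite /Run; set F := Let _ (Step _ _).
have [||j x|y ey] := @ev_fold R (fun j x => exists A r L lom,
    run_inv l j A r L lom /\ x = enc_state A r L lom) O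
  [:: enc_set R (on [::]); Num (4 * l); Num l; enc_set R om;
      enc_nat R (nreq C); d; enc_vec (@cost R C); Cons (enc_nat R (nreq C)) d;
      inst; ks; Cons inst ks; enc_value (l, om);
      Cons (Cons inst ks) (enc_value (l, om))]
  F (nseq (nreq C) Nil)
  (Cons (Cons (enc_nat R (nreq C)) (Cons Nil (Cons (enc_set R (on [::]))
     (Cons (Num 0) (Num 0))))) (enc_value (l, om))) N (Tstep + 20)%N.
- by rewrite size_nseq.
- exists set0, [::], 0, (l, om); split; first exact: (run_inv0 _ on_comp).
  by rewrite /enc_state (enc_set0 (nreq C)) /weights big_set0.
- move=> _ [A [r [L [lom [inv' ->]]]]] tl ll st.
  have [A' [r' [L' [lom' [inv'' step]]]]] := Step_ok l_ge0 inv'.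
  exists (enc_state A' r' L' lom'); last by exists A', r', L', lom'.
  by rewrite /F; eapply ev_le; [eapply ev_call; [ev_auto | exact: step] | lia].
rewrite size_nseq => -[A [r [L [lom [inv' ye]]]]]; rewrite {}ye in ey.
exists lom; split.
  exact: (main_inv_step offP onP on_comp a_off_ge1 w_ge0 b_ge0 M0 M_down
    inv inv').
eapply ev_le.
  do 5 ev_step; eapply ev_let; first by ev_auto.
  eapply ev_let; first by eapply ev_call; [ev_auto | exact: (PonP (s := [::]))].
  eapply ev_let; last by ev_auto.
  by eapply ev_let; last exact: ey; ev_auto.
by rewrite /Trun; lia.
Qed.

Let Tmain := (N * (Trun + 40) + 100)%N.

Lemma Main_ok : exists om l, main_inv (nreq C) l om /\
  outputs_within O (Main Poff Pon) (Cons inst ks) (enc_set R om) Tmain.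
Proof.
rewrite /Main; set F := Let _ (Run _ _).
have [||j x|y ey] := @ev_fold R (fun j x => exists lom,
    main_inv j lom.1 lom.2 /\ x = enc_value lom) O
  [:: enc_nat R (nreq C); d; enc_vec (@cost R C); Cons (enc_nat R (nreq C)) d;
      inst; ks; Cons inst ks]
  F (nseq (nreq C) Nil) (Cons (Num 0) (enc_nat R (nreq C))) N (Trun + 20)%N.
- by rewrite size_nseq.
- exists (0, set0); split; first exact: main_inv0.
  by rewrite /enc_value -(enc_set0 (nreq C)).
- move=> _ [lom [inv ->]] tl ll st.
  have [lom' [inv' run]] := Run_ok inv.
  exists (enc_value lom'); last by exists lom'.
  by rewrite /F; eapply ev_le; [eapply ev_call; [ev_auto | exact: run] | lia].
rewrite size_nseq => -[[l om] [inv ye]]; rewrite {}ye in ey.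
exists om, l; split=> //; eapply ev_le.
  do 3 ev_step; eapply ev_let; last by ev_auto.
  by eapply ev_let; last exact: ey; ev_auto.
by rewrite /Tmain; lia.
Qed.

End MainOk.

(** * Polynomial bounds *)

Section PolynomialBounds.
Local Open Scope nat_scope.

(** For positive [N] the power [N ^ d] is monotone in [d], which lets a sum be bounded by adding
    exponents. *)
Definition poly_bounded (f : nat -> nat) : Prop :=
  exists k d, forall N, 0 < N -> f N <= k * N ^ d.

Lemma poly_bounded_cst c : poly_bounded (fun _ => c).
Proof. by exists c, 0 => N _; rewrite muln1. Qed.

Lemma poly_bounded_id : poly_bounded (fun N => N).
Proof. by exists 1, 1 => N _; rewrite mul1n expn1. Qed.

Lemma poly_bounded_add f g : poly_bounded f -> poly_bounded g ->
  poly_bounded (fun N => f N + g N).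
Proof.
move=> [k [d fP]] [l [e gP]]; exists (k + l), (d + e) => N N_gt0.
rewrite mulnDl; apply: leq_add.
  apply: leq_trans (fP N N_gt0) _.
  by rewrite leq_mul2l leq_pexp2l ?leq_addr ?orbT.
apply: leq_trans (gP N N_gt0) _.
by rewrite leq_mul2l leq_pexp2l ?leq_addl ?orbT.
Qed.

Lemma poly_bounded_mul f g : poly_bounded f -> poly_bounded g ->
  poly_bounded (fun N => f N * g N).
Proof.
move=> [k [d fP]] [l [e gP]]; exists (k * l), (d + e) => N N_gt0.
by rewrite expnD mulnACA leq_mul ?fP ?gP.
Qed.

Lemma poly_bounded_exp f d : poly_bounded f -> poly_bounded (fun N => f N ^ d).
Proof.
move=> fP; elim: d => [|d IH]; first exact: poly_bounded_cst.
have [k [e P]] := poly_bounded_mul fP IH.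
by exists k, e => N /P; rewrite expnS.
Qed.

End PolynomialBounds.

Ltac poly_bounded_tac :=
  repeat first [ apply: poly_bounded_cst | apply: poly_bounded_id
               | apply: poly_bounded_add | apply: poly_bounded_mul
               | apply: poly_bounded_exp ].

Lemma leq_expn2r m n e : (m <= n -> m ^ e <= n ^ e)%N.
Proof. by case: e => // e; rewrite leq_exp2r. Qed.

(** * Sizes of encodings *)

Section Sizes.
Variable R : realFieldType.

Lemma dsize_gt0 (x : data R) : (0 < dsize x)%N.
Proof. by case: x. Qed.

Lemma size_enc_list (s : seq (data R)) : (size s <= dsize (enc_list s))%N.
Proof.
elim: s => //= x s IH; rewrite ltnS.
exact: leq_trans IH (leq_addl _ _).
Qed.

Lemma dsize_enc_list m (s : seq (data R)) :
  all (fun x => dsize x <= m)%N s ->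
  (dsize (enc_list s) <= size s * m.+1 + 1)%N.
Proof.
elim: s => //= x s IH /andP[le_x /IH].
rewrite -/(enc_list s) mulSn => le_s.
by rewrite -addSn -addnA leq_add.
Qed.

Lemma dsize_enc_nat n : (dsize (enc_nat R n) <= n * 2 + 1)%N.
Proof.
rewrite -[n in (n * _)%N](size_nseq n (@Nil R)); apply: dsize_enc_list.
by rewrite all_nseq orbT.
Qed.

Lemma dsize_enc_set n (A : {set 'I_n}) : (dsize (enc_set R A) <= n * 4 + 1)%N.
Proof.
rewrite -[n in (n * _)%N]card_ord cardE.
rewrite -(size_map (fun i => enc_bool R (i \in A))).
apply: dsize_enc_list; rewrite all_map; apply/allP => i _ /=.
by case: (i \in A).
Qed.

Lemma dsize_enc_seq n (s : seq 'I_n) :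
  (dsize (enc_seq R s) <= size s * (2 * n + 2) + 1)%N.
Proof.
have -> : (2 * n + 2 = (2 * n + 1).+1)%N by lia.
rewrite -(size_map (fun i : 'I_n => enc_nat R i)).
apply: dsize_enc_list; rewrite all_map; apply/allP => i _ /=.
by apply: leq_trans (dsize_enc_nat _) _; have := ltn_ord i; lia.
Qed.

Lemma nelt_le_dsize (C : covering R) d : (nelt C < dsize (enc_covering C d))%N.
Proof.
rewrite /= ltnS; apply: leq_trans (leq_addr _ _).
rewrite -[n in (n <= _)%N]card_ord cardE -(size_map (fun e => Num (cost e))).
exact: size_enc_list.
Qed.

Lemma nreq_le_dsize (C : covering R) d : (nreq C < dsize (enc_covering C d))%N.
Proof.
have := size_enc_list (nseq (nreq C) (@Nil R)); rewrite size_nseq /=.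
by rewrite -/(enc_nat R (nreq C)); lia.
Qed.

Lemma dsize_knapsack n q (w : 'I_q -> 'I_n -> R) (b : 'I_q -> R) :
  (q <= dsize (enc_knapsack w b))%N.
Proof.
rewrite -[n in (n <= _)%N]card_ord cardE.
rewrite -(size_map (fun j => Cons (Num (b j)) (enc_vec (w j)))).
exact: size_enc_list.
Qed.

End Sizes.

Lemma augmentation_le (R : realFieldType) (C : covering R) a a' X S A :
  a <= a' -> augmentation (C := C) a X S A -> augmentation a' X S A.
Proof.
move=> le_a [sat le_c]; split=> //; apply: le_trans le_c _.
by rewrite ler_wpM2r // opt_aug_ge0.
Qed.

Lemma competitive_le (R : realFieldType) (C : covering R) a a' on :
  a <= a' -> competitive (C := C) a on -> competitive a' on.
Proof.
move=> le_a comp s; apply: le_trans (comp s) _.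
by rewrite ler_wpM2r // opt_aug_ge0.
Qed.

(** No output beats a positive optimum. *)
Lemma augmentation_ge1 (R : realFieldType) (C : covering R) a
    (X : {set 'I_(nreq C)}) A :
  0 < opt X -> augmentation (C := C) a X set0 A -> 1 <= a.
Proof.
move=> opt_gt0 [sat le_c]; rewrite -(ler_pM2r opt_gt0) mul1r.
by apply: le_trans le_c; apply: opt_aug_le.
Qed.

Lemma competitive_ge1 (R : realFieldType) (C : covering R) a on
    (X : {set 'I_(nreq C)}) :
  0 < opt X -> online_algorithm (C := C) on -> competitive a on -> 1 <= a.
Proof.
move=> opt_gt0 [sat _] /(_ (enum X)); rewrite set_enum => le_c.
rewrite -(ler_pM2r opt_gt0) mul1r; apply: le_trans le_c.
by apply: opt_aug_le; rewrite set0U; have := sat (enum X); rewrite set_enum.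
Qed.

(** Compare [B], as a maximal member inside itself, with itself. *)
Lemma p_system_ge1 (R : realFieldType) n (p : R) (M : {set {set 'I_n}}) B :
  p_system p M -> B \in M -> B != set0 -> 1 <= p.
Proof.
move=> [_ _ ratio] BM; rewrite -card_gt0 => B_gt0.
have maxB : maxset (fun A => (A \in M) && (A \subset B)) B.
  apply/maxsetP; split=> [|A /andP[_ AB] BA]; first by rewrite BM /=.
  by apply/eqP; rewrite eqEsubset AB.
have := ratio B B B maxB maxB; rewrite -[leLHS]mul1r ler_pM2r // ltr0n //.
Qed.

Theorem theorem3p6 :
  exists K : nat,
  forall (R : realFieldType) (I : Type)
         (C : I -> covering R) (desc : I -> data R)
         (alpha_off alpha_on : I -> R),
    poly_time_augmentation C desc alpha_off ->
    poly_time_online C desc alpha_on ->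
    poly_time_max_min C desc
      (fun i p q => K%:R * (p + 1) * (q%:R + 1) * alpha_off i * alpha_on i).
Proof.
exists 8%N => R I C desc alpha_off alpha_on [Poff [ko [eo offP]]].
move=> [on [onP comp [Pon [kn [en on_run]]]]].
(* [13 * N] bounds the size of an instance with two bit vectors, [7 * N * N] that of an instance
   with at most [nreq] requests. *)
pose Toff N := (ko * (13 * N) ^ eo)%N; pose Ton N := (kn * (7 * N * N) ^ en)%N.
pose T N := (
   let Tselect := N * (N * (21 * N + 100) + 120 * N + Toff N + 400) + 100 in
   let Tstep := Tselect + 300 * N + Ton N + 1000 in
   let Trun := N * (Tstep + 40) + Ton N + 300 in N * (Trun + 40) + 100)%N.
have [k [e le_T]] : poly_bounded T by rewrite /T /Toff /Ton /=; poly_bounded_tac.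
exists (Main Poff Pon), k, e => i p M q w b pM w_ge0 b_ge0 Omega x.
pose N := dsize x; have N_gt0 : (0 < N)%N by apply: dsize_gt0.
have [M0 M_down _] := pM.
have NE : N = (dsize (enc_covering (C i) (desc i)) + dsize (enc_knapsack w b)).+1.
  by [].
have elt_N := nelt_le_dsize (C i) (desc i).
have req_N := nreq_le_dsize (C i) (desc i).
have q_N := dsize_knapsack w b.
have le_elt : (nelt (C i) <= N)%N by rewrite NE; clear -elt_N; lia.
have le_req : (nreq (C i) <= N)%N by rewrite NE; clear -req_N; lia.
have le_q : (q <= N)%N by rewrite NE; clear -q_N; lia.
have le_inst : (dsize (enc_covering (C i) (desc i)) < N)%N.
  by rewrite NE ltnS leq_addr.
(* Each input is only known to have some good output; finite choice, over [S] and then [X], gives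
   the function that the greedy analysis needs. *)
have /fin_all_exists [f fP] : forall S : {set 'I_(nelt (C i))}, exists g,
    forall X : {set 'I_(nreq (C i))},
    outputs_within (membership_oracle M) Poff
      (Cons (enc_covering (C i) (desc i)) (Cons (enc_set R S) (enc_set R X)))
      (enc_set R (g X)) (Toff N)
    /\ augmentation (alpha_off i) X S (g X).
  move=> S.
  suff /fin_all_exists [g gP] : forall X : {set 'I_(nreq (C i))}, exists A,
      outputs_within (membership_oracle M) Poff
        (Cons (enc_covering (C i) (desc i)) (Cons (enc_set R S) (enc_set R X)))
        (enc_set R A) (Toff N)
      /\ augmentation (alpha_off i) X S A by exists g.
  move=> X.
  have [A runA augA] := offP i S X; exists A; split=> //.
  apply: outputs_no_oracle; apply: ev_le runA _.
  rewrite /Toff leq_mul2l; apply/orP; right; apply: leq_expn2r.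
  have := dsize_enc_set R S; have := dsize_enc_set R X.
  move: le_inst le_elt le_req N_gt0; rewrite /=; clear.
  by move: (dsize _) (dsize _) (dsize _); lia.
have run_on s : (size s <= nreq (C i))%N -> outputs_within (membership_oracle M)
    Pon (Cons (enc_covering (C i) (desc i)) (enc_seq R s)) (enc_set R (on i s))
    (Ton N).
  move=> le_s; apply: outputs_no_oracle; apply: ev_le (on_run i s) _.
  rewrite /Ton leq_mul2l; apply/orP; right; apply: leq_expn2r.
  have := dsize_enc_seq R s; move: le_inst le_req le_s N_gt0; rewrite /=; clear.
  by move: (dsize _) (dsize _); nia.
(* The analysis wants factors at least 1, while the given ones may be smaller if all optima
   vanish. *)
pose a_off := Num.max 1 (alpha_off i); pose a_on := Num.max 1 (alpha_on i).
have a_off_ge1 : 1 <= a_off by rewrite le_max lexx.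
have a_on_ge1 : 1 <= a_on by rewrite le_max lexx.
have f_aug S X : augmentation a_off X S (f S X).
  by apply: augmentation_le (fP S X).2; rewrite le_max lexx orbT.
have on_comp : competitive a_on (on i).
  by apply: competitive_le (comp i); rewrite le_max lexx orbT.
have [om [l [inv run]]] := Main_ok f_aug (onP i) on_comp a_off_ge1 a_on_ge1
  w_ge0 b_ge0 M0 M_down le_elt le_req le_q (fun S X => (fP S X).1) run_on.
have [[omO _ _] _] := inv; exists om; split=> //.
  by apply: ev_le run _; exact: (le_T N N_gt0).
(* A positive optimum forces both factors and [p] to be at least 1, so the maxima disappear.
   Otherwise both sides of the claim are 0. *)
case: (pickP [pred B in Omega | 0 < opt B]) => [B0 /andP[B0O opt_gt0]|opt0].
  have off_ge1 := augmentation_ge1 opt_gt0 (fP set0 B0).2.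
  have on_ge1 := competitive_ge1 opt_gt0 (onP i) (comp i).
  have p_ge0 : 0 <= p.
    apply: le_trans (p_system_ge1 pM (_ : B0 \in M) _) => //.
      by move: B0O; rewrite inE => /andP[].
    by apply: contraTneq opt_gt0 => ->; rewrite opt_set0 ltxx.
  have bound B : B \in Omega -> opt B <=
      8 * (p + 1) * (q%:R + 1) * alpha_off i * alpha_on i * opt om.
    move=> BO; have := main_result f_aug a_off_ge1 a_on_ge1 w_ge0 M_down inv pM
      p_ge0 BO.
    by rewrite /a_off /a_on !max_r.
  rewrite /max_opt; apply: bigmax_le; last exact: bound.
  by apply: le_trans (bound B0 B0O); apply: opt_aug_ge0.
have opt_eq0 B : B \in Omega -> opt B = 0.
  move=> BO; have := opt0 B; rewrite /= BO /= => /negbT; rewrite -leNgt => le0.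
  by apply/eqP; rewrite eq_le le0 opt_aug_ge0.
rewrite (opt_eq0 om) // mulr0; rewrite /max_opt; apply: bigmax_le => // B BO.
by rewrite opt_eq0.
Qed.
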